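(* Let $D\in\{\mathbb R,\mathbb R^+\}$ and let $F:D\to\mathbb R$ be a warping function with $w=(F^{-1})'\in\mathcal C^1(\mathbb R)$, such that for all $x,y\in\mathbb R$ $$\frac{w(x+y)}{w(x)w(y)}\le C<\infty\quad\text{and}\quad\left|\frac{w'}{w}\right|(x)\le D_1<\infty.$$ Furthermore, let $m_1:D\to\mathbb R^+$ be a weight function such that $m_1\circ F^{-1}$ is $v_1$-moderate for a symmetric, submultiplicative weight function $v_1$, and define $m(x,y,\xi,\omega)=\max\left\{\frac{m_1(x)}{m_1(y)},\frac{m_1(y)}{m_1(x)}\right\}$ for $x,y\in D$, $\xi,\omega\in\mathbb R$. Then $$K_{\theta,F}\in\mathcal A_m\quad\text{for all nonzero }\theta\in\mathcal C_c^\infty(\mathbb R).$$ If furthermore $w,v_1\in\mathcal O\left((1+|\cdot|)^p\right)$ for some $p\in\mathbb R^+$, then $$K_{\theta,F}\in\mathcal A_m\quad\text{for all nonzero }\theta\in\mathcal S(\mathbb R).$$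
   Context: $\mathbb R^+=(0,\infty)$. A weight function $v:\mathbb R\to\mathbb R^+$ is submultiplicative if $v(x+y)\le v(x)v(y)$; a weight function $u:\mathbb R\to\mathbb R^+$ is $v$-moderate if $u(x+y)\le C'v(x)u(y)$ for some submultiplicative weight $v$ and constant $C'<\infty$. $\mathcal O(f)$ denotes the functions that do not grow faster than $f$; $\mathcal S(\mathbb R)$ is the Schwartz class. A bijective function $F:D\to\mathbb R$ is a warping function if $F\in\mathcal C^1(D)$, $F'>0$, $|t_0|<|t_1|\Rightarrow F'(t_1)<F'(t_0)$, and the weight $w(t)=(F^{-1})'(t)=1/F'(F^{-1}(t))$ is $v$-moderate for some submultiplicative weight $v$; if $D=\mathbb R$, $F$ is additionally required to be odd. Fourier transform: $\mathcal Ff(\xi)=\int_{\mathbb R}f(t)e^{-2\pi it\xi}dt$, extended unitarily to $\mathbf L^2(\mathbb R)$; $\check g=\mathcal F^{-1}g$; functions on $D$ are extended by zero to $\mathbb R$. $\mathbf T_xf=f(\cdot-x)$. For $(x,\xi)\in D\times\mathbb R$ let $g_x:=\sqrt{F'(x)}\,(\mathbf T_{F(x)}\theta)\circ F$ and $g_{x,\xi}:=\mathbf T_\xi\,\check{g_x}$. The system $\{g_{x,\xi}\}$ is a continuous tight frame for $\mathcal F^{-1}(\mathbf L^2(D))$ with bound $A=\|\theta\|_{\mathbf L^2}^2$, and $$K_{\theta,F}(x,y,\xi,\omega):=A^{-1}\langle g_{y,\omega},g_{x,\xi}\rangle,$$ a kernel on $(D\times\mathbb R)\times(D\times\mathbb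 R)$ with points $(x,\xi)$ and $(y,\omega)$. For a kernel $K$ on $(D\times\mathbb R)^2$, $\|K\|_{\mathcal A_1}=\max\{\mathrm{ess\,sup}_{(x,\xi)}\int_D\int_{\mathbb R}|K(x,y,\xi,\omega)|\,d\omega\,dy,\ \mathrm{ess\,sup}_{(y,\omega)}\int_D\int_{\mathbb R}|K(x,y,\xi,\omega)|\,d\xi\,dx\}$, and $\mathcal A_m$ is the space of kernels with $\|K\|_{\mathcal A_m}:=\|Km\|_{\mathcal A_1}<\infty$. *)

(* Defs.v *)
From HB Require Import structures.
From mathcomp Require Import all_boot all_order all_algebra.
From mathcomp Require Import all_classical all_reals all_analysis.
From mathcomp Require Import ess_sup_inf complex.
Set Implicit Arguments.
Unset Strict Implicit.
Unset Printing Implicit Defensive.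
Import Order.TTheory GRing.Theory Num.Theory.
Import numFieldNormedType.Exports.
Import ComplexField.Normc.

Local Open Scope classical_set_scope.
Local Open Scope complex_scope.
Local Open Scope ring_scope.

Section Weights.
Context {R : realType}.
Implicit Types (u v : R -> R) (D : set R).

Definition weight_on D u := forall x, D x -> 0 < u x.

Definition weight u := weight_on setT u.

Definition submultiplicative_weight v :=
  weight v /\ forall x y, v (x + y) <= v x * v y.

Definition moderate v u :=
  [/\ submultiplicative_weight v, weight u &
      exists C' : R, forall x y, u (x + y) <= C' * v x * u y].

Definition symmetric_weight v := forall x, v (- x) = v x.

(* u is in O(f) at both ends of the real line *)
Definition big_O u (f : R -> R) :=
  (exists C : R, \forall x \near +oo_R, `|u x| <= C * `|f x|) /\
  (exists C : R, \forall x \near -oo_R, `|u x| <= C * `|f x|).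

Definition poly_growth u (p : R) := big_O u (fun x => (1 + `|x|) `^ p).

End Weights.

Section Warping.
Context {R : realType}.
Implicit Types (D : set R) (F : R -> R).

(* Functions on an open set D are total functions on R whose values outside D
   are irrelevant. *)
Definition C1_on D F :=
  forall x, D x -> derivable F x 1 /\ {for x, continuous (derive1 F)}.

(* F^-1; for F bijective from D onto R, pinv D F is the two-sided inverse,
   with values in D. *)
Definition warp_inv D F : R -> R := pinv D F.

Definition warp_weight D F : R -> R := derive1 (warp_inv D F).

Definition warping D F :=
  [/\ set_bij D setT F,
      C1_on D F,
      forall t, D t -> 0 < derive1 F t,
      forall t0 t1, D t0 -> D t1 -> `|t0| < `|t1| -> derive1 F t1 < derive1 F t0 &
      (exists v, moderate v (warp_weight D F)) /\
      (D = setT -> forall t, F (- t) = - F t)].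

End Warping.

Section Complex.
Context {R : realType}.
Implicit Types (f g : R -> R[i]) (D : set R).

Let mu := @lebesgue_measure R.

Definition cintegral f : R[i] :=
  Rintegral mu setT (fun t => complex.Re (f t)) +i*
  Rintegral mu setT (fun t => complex.Im (f t)).

Definition inner f g : R[i] := cintegral (fun t => f t * (g t)^*).

Definition sqnormL2 f : R := Rintegral mu setT (fun t => normc (f t) ^+ 2).

Definition expi (a : R) : R[i] := cos a +i* sin a.

(* The integral formula for the inverse Fourier transform.  It agrees almost
   everywhere with the unitary extension to L^2 on the whole of
   L^1 `&` L^2; see [warped] for why this is enough here. *)
Definition inv_fourier f : R -> R[i] :=
  fun xi => cintegral (fun t => f t * expi (2 * pi * t * xi)).

Definition translate (x : R) f : R -> R[i] := fun t => f (t - x).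

Definition zero_ext D f : R -> R[i] := fun t => if t \in D then f t else 0.

Definition Re_fun f : R -> R := fun t => complex.Re (f t).
Definition Im_fun f : R -> R := fun t => complex.Im (f t).

Definition smooth_real (h : R -> R) :=
  forall (n : nat) (x : R), derivable (derive1n n h) x 1.

Definition rapidly_decreasing (h : R -> R) :=
  forall j k : nat, exists M : R, forall x, `|x| ^+ j * `|derive1n k h x| <= M.

Definition smooth f := smooth_real (Re_fun f) /\ smooth_real (Im_fun f).

Definition Cc_infty f := smooth f /\ compact (closure [set x | f x != 0]).

Definition schwartz f :=
  [/\ smooth f, rapidly_decreasing (Re_fun f) & rapidly_decreasing (Im_fun f)].

End Complex.

Section Kernels.
Context {R : realType}.
Implicit Types (D : set R) (F : R -> R) (theta : R -> R[i]).

Let mu := @lebesgue_measure R.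

(* g_x.  The substitution s = F t gives
     \int_D |g_x| = sqrt (F' x) * \int_R |theta (s - F x)| * w s ds,
   so g_x is integrable as soon as theta is compactly supported, or theta is
   Schwartz and w has polynomial growth; it is always square-integrable. *)
Definition warped D F theta (x : R) : R -> R[i] :=
  zero_ext D
    (fun t => (Num.sqrt (derive1 F x))%:C * (translate (F x) theta \o F) t).

(* g_{x,xi} *)
Definition atom D F theta (x xi : R) : R -> R[i] :=
  translate xi (inv_fourier (warped D F theta x)).

(* Kernels on (D * R) * (D * R) take their arguments in the order
   x, y, xi, omega, where the two points are (x, xi) and (y, omega). *)
Definition kernel_K D F theta (x y xi omega : R) : R[i] :=
  (sqnormL2 theta)^-1%:C *
  inner (atom D F theta y omega) (atom D F theta x xi).

Local Open Scope ereal_scope.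

(* Essential supremum over D * R of a nonnegative function; setting it to 0
   outside D * R does not change it, as D is not negligible. *)
Definition ess_sup_DR D (f : R -> R -> \bar R) : \bar R :=
  ess_sup (mu \x mu)%E (fun p : R * R => if p.1 \in D then f p.1 p.2 else 0).

(* ||K||_{A_1}, as a function of the modulus k = |K| *)
Definition norm_A1 D (k : R -> R -> R -> R -> R) : \bar R :=
  maxe
    (ess_sup_DR D (fun x xi =>
       \int[mu]_(y in D) \int[mu]_(omega in setT) (k x y xi omega)%:E))
    (ess_sup_DR D (fun y omega =>
       \int[mu]_(x in D) \int[mu]_(xi in setT) (k x y xi omega)%:E)).

(* ||K||_{A_m}, for a positive weight m *)
Definition norm_Am D (m : R -> R -> R -> R -> R)
    (K : R -> R -> R -> R -> R[i]) : \bar R :=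
  norm_A1 D (fun x y xi omega => normc (K x y xi omega) * m x y xi omega)%R.

Definition jointly_measurable D (K : R -> R -> R -> R -> R[i]) :=
  let DR2 := [set p : (R * R) * (R * R) | D p.1.1 /\ D p.2.1] in
  let K' := fun p : (R * R) * (R * R) => K p.1.1 p.2.1 p.1.2 p.2.2 in
  measurable_fun DR2 (fun p => complex.Re (K' p)) /\
  measurable_fun DR2 (fun p => complex.Im (K' p)).

Definition in_Am D m K := jointly_measurable D K /\ norm_Am D m K < +oo.

End Kernels.

Section Ratio.
Context {R : realType}.

Definition ratio_weight (m1 : R -> R) (x y xi omega : R) : R :=
  Num.max (m1 x / m1 y) (m1 y / m1 x).

End Ratio.

(* Main.v *)
Require Import Defs.
From HB Require Import structures.
From mathcomp Require Import all_boot all_order all_algebra.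
From mathcomp Require Import all_classical all_reals all_analysis.
From mathcomp Require Import ess_sup_inf complex.
From mathcomp Require Import measurable_realfun ring lra.
Import Order.TTheory GRing.Theory Num.Theory.
Import numFieldNormedType.Exports.
Local Open Scope classical_set_scope.
Local Open Scope ring_scope.

Set Implicit Arguments.
Unset Strict Implicit.
Unset Printing Implicit Defensive.

(** Write X = F x, Y = F y, eta = xi - omega, and w for the derivative of the
    inverse of F.  By Parseval's identity the kernel at (x, y, xi, omega) is, up
    to the factor 1 / ||theta||^2, the inverse Fourier integral at the frequency
    eta of the product g_y * conj g_x, that is, of the function
      t |-> sqrt (F' x * F' y) * A (F t)  on D,
      with A r = theta (r - Y) * conj (theta (r - X)).
    Three facts make it summable.

    - Decay in frequency.  Since F' = 1 / w o F, two integrations by parts in t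
      replace A by (A' / w)' / w divided by (2 pi eta)^2.  Only one derivative
      of w occurs, and |w' / w| <= D1 controls it ([osc_le_freq]).
      Together with the trivial bound this gives the profile
      w X / (1 + (w X * eta)^2) of [osc_lorentz], whose integral over eta is pi.

    - Decay in the warped position.  Let rho be an even submultiplicative
      function, at least 1 + z^2, such that w X <= rho (X - Y) * w Y and
      similarly for m1 o F^-1.  If theta and its first two derivatives are
      O(rho^-8), then A and its first two derivatives carry the factor
      rho (X - Y)^-6, because rho (X - Y) <= rho (r - Y) * rho (r - X)
      ([rapid_controlledM]).  Five of these six powers are left in [kernel_le];
      they also pay for ratios of values of w and for the weight m.

    - Integration over D.  After the integration in frequency, the integrand in
      y is at most a constant times F' y / (1 + (F y - X)^2), the derivative of
      atan (F y - X), so its integral over D is at most pi times that constant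
      ([double_integral_le]).  This primitive replaces every change of
      variables by F.

    The two halves of the theorem differ only by the choice of rho.  For theta
    with compact support, rho is an exponential: the bound on w' / w makes the
    logarithm of w Lipschitz, and m1 o F^-1 has bounded ratios over unit
    distances by a measure-theoretic uniform boundedness argument
    ([bounded_oscillation]); v1 alone does not give this, because a
    submultiplicative function can be unbounded on every interval.  For Schwartz
    theta, rho is a power of 1 + |z|.

    Parseval's identity ([parseval]) comes from Fubini's theorem and pointwise
    Fourier inversion.  Inversion is proved by Abel summation: the multiplier
    exp (- eps |s|) turns the inversion integral into a convolution with the
    Poisson kernel, an approximate identity as eps tends to 0
    ([cos_inversion]). *)

(** * The fundamental theorem of calculus on an exhausted open set *)

Section Exhaustion.
Context {R : realType}.
Local Notation mu := (@lebesgue_measure R).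

(** An integral over D is a limit of integrals over the compact intervals
    [a n, b n], on which the fundamental theorem of calculus applies. *)
Definition exhausts (D : set R) (a b : R^nat) :=
  [/\ forall n, a n < b n, nondecreasing_seq (fun n => `[a n, b n]%classic : set R)
    & D = \bigcup_n `[a n, b n]%classic].

Lemma is_derive_continuous (f : R -> R) (x l : R) :
  is_derive x 1 f l -> {for x, continuous f}.
Proof. by move=> [df _]; apply/differentiable_continuous/derivable1_diffP. Qed.

Lemma FTC_itv (e f : R -> R) (a b : R) : a < b ->
  (forall x, a <= x <= b -> is_derive x 1 e (f x)) ->
  (forall x, a <= x <= b -> {for x, continuous f}) ->
  (\int[mu]_(x in `[a, b]) (f x)%:E = (e b)%:E - (e a)%:E)%E.
Proof.
move=> ab de cf.
have cf' : {within `[a, b], continuous f}.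
  by apply: continuous_in_subspaceT => x /set_mem /=; rewrite in_itv => /cf.
apply: continuous_FTC2 => //.
- split.
  + move=> x; rewrite in_itv /= => /andP[ax xb].
    by have [] := de x; rewrite // !ltW.
  + apply: cvg_at_right_filter; apply: (@is_derive_continuous _ _ (f a)).
    by apply: de; rewrite lexx ltW.
  + apply: cvg_at_left_filter; apply: (@is_derive_continuous _ _ (f b)).
    by apply: de; rewrite lexx ltW.
- move=> x; rewrite in_itv /= => /andP[ax xb].
  have xab : a <= x <= b by rewrite !ltW.
  by rewrite derive1E; have [_ ->] := de _ xab.
Qed.

Variables (D : set R) (a b : R^nat) (e f : R -> R).
Hypotheses (oD : open D) (exD : exhausts D a b).
Hypothesis de : forall x, D x -> is_derive x 1 e (f x).
Hypothesis cf : forall x, D x -> {for x, continuous f}.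

Let sub n x : a n <= x <= b n -> D x.
Proof. by move=> xn; case: exD => _ _ ->; exists n => //=; rewrite in_itv. Qed.

Let FTCn n : (\int[mu]_(x in `[a n, b n]) (f x)%:E = (e (b n))%:E - (e (a n))%:E)%E.
Proof.
by apply: FTC_itv; [case: exD | move=> x /sub; exact: de | move=> x /sub; exact: cf].
Qed.

Lemma open_continuous_measurable : measurable_fun D f.
Proof. by apply: open_continuous_measurable_fun => // x /set_mem; exact: cf. Qed.

(** By monotone convergence, a bound on the primitive bounds the integral of a
    nonnegative function. *)
Lemma ge0_FTC_exhaustion_le (M : R) :
  (forall x, D x -> 0 <= f x) -> (forall x, D x -> `|e x| <= M) ->
  (\int[mu]_(x in D) (f x)%:E <= (2 * M)%:E)%E.
Proof.
move=> f0 eM; have [ab nd DE] := exD.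
have mf := open_continuous_measurable.
have H : (\int[mu]_(x in `[a n, b n]) (f x)%:E)%E @[n --> \oo] -->
    (\int[mu]_(x in \bigcup_n `[a n, b n]%classic) (f x)%:E)%E.
  apply: ge0_nondecreasing_set_cvg_integral => //.
  - move=> n; apply/measurable_EFinP; apply: measurable_funS mf.
      exact: open_measurable.
    by move=> x /=; rewrite in_itv => /sub.
  - by move=> n x /=; rewrite in_itv => /sub /f0; rewrite lee_fin.
rewrite DE; apply: (cvge_to_le H).
  apply: nearW => n; rewrite FTCn -EFinB lee_fin.
  have ea : `|e (a n)| <= M by apply/eM/(@sub n); rewrite lexx ltW.
  have eb : `|e (b n)| <= M by apply/eM/(@sub n); rewrite lexx ltW.
  by move: ea eb; rewrite !ler_norml => /andP[? ?] /andP[? ?]; lra.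
Qed.

(** Without a sign condition, the truncated integrals converge by dominated
    convergence, with the integrand itself as the dominating function. *)
Lemma FTC_exhaustion (l L : R) :
  mu.-integrable D (EFin \o f) ->
  e \o a @ \oo --> l -> e \o b @ \oo --> L ->
  (\int[mu]_(x in D) (f x)%:E = (L - l)%:E)%E.
Proof.
move=> fi el eL; have [ab nd DE] := exD.
have mD : measurable D by exact: open_measurable.
have mf := open_continuous_measurable.
pose g n : R -> \bar R := (EFin \o f) \_ `[a n, b n].
have gE n : (\int[mu]_(x in D) g n x = (e (b n) - e (a n))%:E)%E.
  rewrite -integral_mkcondr (_ : D `&` _ = `[a n, b n]%classic) ?FTCn//.
  by apply/setIidr => x /=; rewrite in_itv => /sub.
have [|||||_ _] := @dominated_convergence _ _ R mu D mD g (EFin \o f) (abse \o EFin \o f).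
- move=> n; apply/measurable_restrict => //.

  by apply/measurable_EFinP; apply: measurable_funS mf => //; exact: subIsetl.
- exact/measurable_EFinP.
- apply: aeW => x Dx.
  apply/cvg_ballP => eps eps0.
  move: Dx; rewrite DE => -[N _ xN].
  exists N => // n /= Nn; rewrite /g patchE mem_set; first exact: ballxx.
  by move/subsetPset: (nd _ _ Nn); exact.
- exact: integrable_abse.
- apply: aeW => x n Dx; rewrite /g patchE; case: ifP => _ //=.
  by rewrite lee_fin normr0.
under eq_fun do rewrite gE.
move=> /cvg_lim <- //; apply/cvg_lim => //.
apply: cvg_EFin; first by apply: nearW.
exact: cvgB.
Qed.

End Exhaustion.

(** * The Lorentz profile *)

Section LorentzKernel.
Context {R : realType}.
Local Notation mu := (@lebesgue_measure R).

Lemma exhaustsT : @exhausts R setT (fun n => - n.+1%:R) (fun n => n.+1%:R).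
Proof.
split.
- by move=> n; rewrite -subr_gt0 opprK addr_gt0.
- move=> n m nm; apply/subsetPset => x /=; rewrite !in_itv /= => /andP[xn xm].
  have nm' : (n.+1%:R : R) <= m.+1%:R by rewrite ler_nat.
  by rewrite (le_trans _ xn) ?lerN2// (le_trans xm).
- apply/seteqP; split=> // x _.
  exists (Num.trunc `|x|) => //=; rewrite in_itv /= -ler_norml ltW//.
  exact: truncnS_gt.
Qed.

Lemma continuous_integral_le (f e : R -> R) (M : R) :
  (forall x : R, is_derive x 1 e (f x)) -> continuous f ->
  (forall x, 0 <= f x) -> (forall x, `|e x| <= M) ->
  (\int[mu]_x (f x)%:E <= (2 * M)%:E)%E.
Proof.
move=> de cf f0 eM.
by apply: (@ge0_FTC_exhaustion_le _ _ _ _ e _ (@openT _) exhaustsT) => // x _; exact: cf.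
Qed.

(** With the factor c in the numerator this is the derivative of
    atan (c * (x - x0)), so that its integral is pi for every c > 0.  It serves as
    the Poisson kernel, as the decay profile of oscillatory integrals, and as a
    generic integrable majorant. *)
Definition lorentz (c x0 x : R) : R := c / (1 + (c * (x - x0)) ^+ 2).

Lemma onepsqr_gt0 (x : R) : 0 < 1 + x ^+ 2.
Proof. by rewrite ltr_pwDl// sqr_ge0. Qed.

Lemma lorentz_ge0 (c x0 x : R) : 0 <= c -> 0 <= lorentz c x0 x.
Proof. by move=> c0; rewrite divr_ge0// ltW// onepsqr_gt0. Qed.

Lemma is_derive_lorentz (c x0 x : R) :
  is_derive x 1 (fun x : R => atan (c * (x - x0))) (lorentz c x0 x).
Proof.
have H : is_derive x 1 (fun x : R => c * (x - x0)) c.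
  by apply: is_derive_eq; rewrite subr0 scaler1.
rewrite /lorentz mulrC.
exact: (@is_derive1_comp _ atan (fun x => c * (x - x0))).
Qed.

Lemma continuous_lorentz (c x0 : R) : continuous (lorentz c x0).
Proof.
move=> x; rewrite /lorentz; apply: cvgM; first exact: cvg_cst.
apply: cvgV; first by rewrite gt_eqF// onepsqr_gt0.
apply: cvgD; first exact: cvg_cst.
rewrite expr2; apply: cvgM.
all: apply: cvgM; [exact: cvg_cst|apply: cvgB; [exact: cvg_id|exact: cvg_cst]].
Qed.

Lemma atan_le_pihalf (x : R) : `|atan x| <= pi / 2.
Proof. by rewrite ler_norml !ltW ?atan_ltpi2// ?atan_gtNpi2. Qed.

Lemma measurable_lorentz (c x0 : R) : measurable_fun setT (lorentz c x0).
Proof. apply: continuous_measurable_fun; exact: continuous_lorentz. Qed.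

Lemma integral_lorentz_le (c x0 : R) : 0 <= c ->
  (\int[mu]_x (lorentz c x0 x)%:E <= pi%:E)%E.
Proof.
move=> c0; rewrite [X in (_ <= X%:E)%E](_ : pi = 2 * (pi / 2)); last by field.
apply: (@continuous_integral_le _ (fun x => atan (c * (x - x0)))).
- exact: is_derive_lorentz.
- exact: continuous_lorentz.
- by move=> x; exact: lorentz_ge0.
- by move=> x; exact: atan_le_pihalf.
Qed.

Lemma integrable_lorentz (c x0 : R) : 0 <= c ->
  mu.-integrable setT (EFin \o lorentz c x0).
Proof.
move=> c0; apply/integrableP; split; first by apply/measurable_EFinP; exact: measurable_lorentz.
under eq_integral => x _ do rewrite /= ger0_norm ?lorentz_ge0//.
by rewrite (le_lt_trans (integral_lorentz_le _ c0))// ltry.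
Qed.

Lemma integral_lorentz (c x0 : R) : 0 < c ->
  (\int[mu]_x (lorentz c x0 x)%:E = pi%:E)%E.
Proof.
move=> c0; have c0' := ltW c0.
have cy : (c * (n.+1%:R - x0)) @[n --> \oo] --> +oo.
  apply/cvgryPge => A; near=> n; rewrite mulrC -ler_pdivrMr// lerBrDr.
  rewrite (@le_trans _ _ n%:R)// ?ler_nat//.
  near: n; exact: nbhs_infty_ger.
have cy' : (c * (n.+1%:R + x0)) @[n --> \oo] --> +oo.
  apply/cvgryPge => A; near=> n; rewrite mulrC -ler_pdivrMr// -lerBlDr.
  rewrite (@le_trans _ _ n%:R)// ?ler_nat//.
  near: n; exact: nbhs_infty_ger.
rewrite (@FTC_exhaustion _ _ _ _ (fun x => atan (c * (x - x0))) _ (@openT _)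
  exhaustsT _ _ (- (pi / 2)) (pi / 2)).
- by congr EFin; field.
- by move=> x _; exact: is_derive_lorentz.
- by move=> x _; exact: continuous_lorentz.
- exact: integrable_lorentz.
- rewrite (_ : _ \o _ = (fun n => - atan (c * (n.+1%:R + x0)))).
    by apply: cvgN; apply: (cvg_comp _ _ cy'); exact: cvgy_atan.
  by apply/funext => n /=; rewrite -atanN -mulrN opprD.
- by apply: (cvg_comp _ _ cy); exact: cvgy_atan.
Unshelve. all: by end_near.
Qed.

End LorentzKernel.

(** * Parameter integrals and invariance of the Lebesgue measure *)

Section Integrals.
Context {R : realType}.
Local Notation mu := (@lebesgue_measure R).

(** The parameter integral is the difference of those of the positive and negative
    parts, both measurable by Tonelli's theorem. *)
Lemma measurable_Rintegral d (T : measurableType d) (f : T * R -> R) :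
  measurable_fun setT f -> measurable_fun setT (fun x => \int[mu]_t f (x, t)).
Proof.
move=> mf; pose g := EFin \o f.
have mg : measurable_fun setT g by exact/measurable_EFinP.
rewrite (_ : (fun _ => _) = fine \o
  (fun x => fubini_F mu g^\+ x - fubini_F mu g^\- x)%E).
  apply: measurableT_comp; first exact: fine_measurable.
  apply: emeasurable_funB; apply: measurable_fun_fubini_tonelli_F => //.
    exact: measurable_funepos.
  exact: measurable_funeneg.
apply/funext => x; rewrite /Rintegral integralE /=; congr (fine (_ - _)%E).
  by apply: eq_integral => t _; rewrite !funeposE.
by apply: eq_integral => t _; rewrite !funenegE.
Qed.

(** Both integrals are differences of integrals of the positive and negative
    parts, to which the image measure formula applies. *)
Lemma integral_preserving (phi : R -> R) (f : R -> \bar R) :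
  measurable_fun setT phi ->
  (forall A, measurable A -> pushforward mu (phi : _ -> measurableTypeR R) A = mu A) ->
  measurable_fun setT f -> (\int[mu]_x f (phi x) = \int[mu]_x f x)%E.
Proof.
move=> mphi phiE.
have H (h : R -> \bar R) : measurable_fun setT h -> (forall x, 0 <= h x)%E ->
    (\int[mu]_x h (phi x) = \int[mu]_x h x)%E.
  move=> mh h0; transitivity
    (\int[pushforward mu (phi : _ -> measurableTypeR R)]_y h y)%E.
    by rewrite ge0_integral_pushforward ?preimage_setT.
  by apply: eq_measure_integral => A mA _; exact: phiE.
move=> mf; rewrite integralE [RHS]integralE; congr (_ - _)%E.
- transitivity (\int[mu]_x (f^\+ (phi x)))%E.
    by apply: eq_integral => x _; rewrite !funeposE.
  by apply: H => //; exact: measurable_funepos.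
- transitivity (\int[mu]_x (f^\- (phi x)))%E.
    by apply: eq_integral => x _; rewrite !funenegE.
  by apply: H => //; exact: measurable_funeneg.
Qed.

Lemma RintegralNx (f : R -> R) : measurable_fun setT f ->
  \int[mu]_x f (- x) = \int[mu]_x f x.
Proof.
move=> mf; congr fine.
apply: (@integral_preserving -%R (EFin \o f)); first exact: oppr_measurable.
  by move=> A mA; exact: lebesgue_measureN.
exact/measurable_EFinP.
Qed.

Lemma lebesgue_measure_shift (c : R) A : measurable A ->
  pushforward mu ((fun x => x - c) : _ -> measurableTypeR R) A = mu A.
Proof.
have mc : measurable_fun [set: R] ((fun x => x - c) : _ -> measurableTypeR R).
  by apply: measurable_funB.
move=> mA; apply/esym.
apply: (@lebesgue_measure_unique R (pushforward mu
  ((fun x => x - c) : _ -> measurableTypeR R))) => //= _ [[a b]] _ <-.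
rewrite /pushforward (_ : _ @^-1` _ = `](a + c), (b + c)]%classic).
  rewrite !lebesgue_measure_itv/= !lte_fin ltrD2r.
  by case: ifP => // _; congr EFin; ring.
by apply/seteqP; split => x /=; rewrite !in_itv /= ltrBrDr lerBlDr.
Qed.

Lemma Rintegral_shift (f : R -> R) c : measurable_fun setT f ->
  \int[mu]_x f (x - c) = \int[mu]_x f x.
Proof.
move=> mf; congr fine.
apply: (@integral_preserving (fun x => x - c) (EFin \o f)).
- by apply: measurable_funB.
- by move=> A mA; exact: lebesgue_measure_shift.
- exact/measurable_EFinP.
Qed.

Lemma integrable_shift (f : R -> R) c : mu.-integrable setT (EFin \o f) ->
  mu.-integrable setT (EFin \o (fun x => f (x - c))).
Proof.
move=> /integrableP[/measurable_EFinP mf foo].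
have mc : measurable_fun [set: R] (fun x => x - c) by apply: measurable_funB.
apply/integrableP; split.
  by apply/measurable_EFinP; apply: measurableT_comp.
rewrite (@integral_preserving (fun x => x - c) (fun x => `|f x|%:E))//.
- by move=> A mA; exact: lebesgue_measure_shift.
- by apply/measurable_EFinP; apply: measurableT_comp.
Qed.

Lemma le_integrableT (f g : R -> R) : measurable_fun setT f ->
  (forall x, `|f x| <= g x) -> mu.-integrable setT (EFin \o g) ->
  mu.-integrable setT (EFin \o f).
Proof.
move=> mf fg; apply: le_integrable => //; first exact/measurable_EFinP.
by move=> x _ /=; rewrite lee_fin (le_trans (fg x))// ler_norm.
Qed.

Lemma integrable_le_bound (f : R -> R) (M : R) : measurable_fun setT f ->
  (\int[mu]_x `|f x|%:E <= M%:E)%E -> mu.-integrable setT (EFin \o f).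
Proof.
move=> mf fM; apply/integrableP; split; first exact/measurable_EFinP.
by rewrite (le_lt_trans fM)// ltry.
Qed.

Lemma integrable_prod (f g : R -> R) :
  mu.-integrable setT (EFin \o f) -> mu.-integrable setT (EFin \o g) ->
  (mu \x mu)%E.-integrable setT (EFin \o (fun p : R * R => f p.1 * g p.2)).
Proof.
move=> fi gi.
have [mf fy] := integrableP _ _ _ fi; have [mg gy] := integrableP _ _ _ gi.
apply/integrable12ltyP.
  apply/measurable_EFinP; apply: measurable_funM.
    by apply: measurableT_comp => //; exact/measurable_EFinP.
  by apply: measurableT_comp => //; exact/measurable_EFinP.
rewrite (_ : (fun _ => _) = (fun x => (`|f x|%:E * \int[mu]_y `|g y|%:E)%E)).
  rewrite ge0_integralZr//.
  - by apply: lte_mul_pinfty => //; [exact: integral_ge0|rewrite ge0_fin_numE//; exact: integral_ge0].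
  - by apply/measurable_EFinP; apply: measurableT_comp => //; exact/measurable_EFinP.
  - exact: integral_ge0.
apply/funext => x; rewrite -ge0_integralZl//.
- by apply: eq_integral => y _; rewrite -EFinM /= normrM.
- by apply/measurable_EFinP; apply: measurableT_comp => //; exact/measurable_EFinP.
Qed.

End Integrals.

(** * The Fourier transform of exp (- eps |s|) *)

Section AbelTransform.
Context {R : realType}.
Local Notation mu := (@lebesgue_measure R).

Section eps.
Variables (eps : R).
Hypothesis eps0 : 0 < eps.

(** Adding 1 to the cosine makes the integrand nonnegative and even, so that the
    integral is twice a half-line integral given by the value of a primitive. *)
Lemma integral_expR_cos1 (u : R) :
  (\int[mu]_s (expR (- (eps * `|s|)) * (1 + cos (u * s)))%:E =
   (2 * (eps^-1 + eps / (eps ^+ 2 + u ^+ 2)))%:E)%E.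
Proof.
have D0 : 0 < eps ^+ 2 + u ^+ 2 by rewrite ltr_pwDl ?exprn_gt0 ?sqr_ge0.
have c0 (v : R) : 0 <= 1 + cos v by have := cos_geN1 v; lra.
rewrite ge0_symfun_integralT; first last.
- by move=> x /=; rewrite normrN mulrN cosN.
- move=> x; apply: cvgM.
    apply: continuous_comp; last exact: continuous_expR.
    apply: cvgN; apply: cvgM; [exact: cvg_cst|exact: norm_continuous].
  apply: cvgD; first exact: cvg_cst.
  apply: continuous_comp; last exact: continuous_cos.
  by apply: cvgM; [exact: cvg_cst|exact: cvg_id].
- by move=> x; rewrite mulr_ge0 ?expR_ge0.
rewrite EFinM -set_itvcy; congr (_ * _)%E.
pose h s := expR (- (eps * s)) * (1 + cos (u * s)).
(* a primitive of h, found by integrating expR (- (eps * s)) * cos (u * s)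
   by parts twice *)
pose H s := expR (- (eps * s)) *
  ((u * sin (u * s) - eps * cos (u * s)) / (eps ^+ 2 + u ^+ 2) - eps^-1).
have dH (s : R) : is_derive s 1 H (h s).
  have de : is_derive s 1 (fun s : R => expR (- (eps * s))) (- eps * expR (- (eps * s))).
    rewrite [X in is_derive _ _ _ X]mulrC; apply: (@is_derive1_comp _ expR (fun s => - (eps * s))).
    by apply: is_derive_eq; rewrite scaler1.
  have us : is_derive s 1 (fun s : R => u * s) u.
    by apply: is_derive_eq; rewrite scaler1.
  have ds : is_derive s 1 (fun s : R => sin (u * s)) (cos (u * s) * u).
    exact: (@is_derive1_comp _ sin (fun s => u * s)).
  have dc : is_derive s 1 (fun s : R => cos (u * s)) (- sin (u * s) * u).
    exact: (@is_derive1_comp _ cos (fun s => u * s)).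
  rewrite /H /h; apply: is_derive_eq; rewrite /GRing.scale /=.
  by field; rewrite !gt_eqF.
transitivity (\int[mu]_(x in `[0%R, +oo[) (h x)%:E)%E.
  apply: eq_integral => x; rewrite inE /= in_itv /= andbT => x0.
  by rewrite ger0_norm.
rewrite (@ge0_continuous_FTC2y _ h H 0 0).
- rewrite -EFinB /H !mulr0 oppr0 expR0 cos0 sin0.
  by congr EFin; field; rewrite !gt_eqF.
- by move=> x _; rewrite mulr_ge0 ?expR_ge0.
- apply: continuous_subspaceT => x; apply: cvgM.
    apply: continuous_comp; last exact: continuous_expR.
    apply: cvgN; apply: cvgM; [exact: cvg_cst|exact: cvg_id].
  apply: cvgD; first exact: cvg_cst.
  apply: continuous_comp; last exact: continuous_cos.
  by apply: cvgM; [exact: cvg_cst|exact: cvg_id].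
- pose M := (`|u| + eps) / (eps ^+ 2 + u ^+ 2) + eps^-1.
  have HM s : `|H s| <= expR (- (eps * s)) * M.
    rewrite normrM ger0_norm ?expR_ge0// ler_wpM2l ?expR_ge0//.
    rewrite (le_trans (ler_normB _ _))// lerD//; last by rewrite ger0_norm// invr_ge0 (ltW eps0).
    rewrite normrM [X in _ * X]ger0_norm ?invr_ge0 ?(ltW D0)//.
    rewrite ler_pM2r ?invr_gt0// (le_trans (ler_normB _ _))// !normrM.
    rewrite (ger0_norm (ltW eps0)) lerD//.
      by rewrite -[leRHS]mulr1 ler_wpM2l// ler_norml sin_geN1 sin_le1.
    by rewrite -[leRHS]mulr1 (ler_wpM2l (ltW eps0))// ler_norml cos_geN1 cos_le1.
  have E0 : expR (- (eps * s)) * M @[s --> +oo] --> 0.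
    rewrite -[X in _ --> X](mul0r M); apply: cvgMl.
    apply: (@cvg_comp _ _ _ (fun s => eps * s) (fun s => expR (- s)) _ +oo%R); last exact: cvgr_expR.
    apply/cvgryPge => A; near=> s; rewrite mulrC -ler_pdivrMr//.
  apply/norm_cvg0P.
  apply: (squeeze_cvgr _ (@cvg_cst _ (0:R) _ _ _) E0).
  by apply: nearW => s; rewrite normr_ge0 HM.
- by move=> x _; have [] := dH x.
- by apply: cvg_at_right_filter; exact: (@is_derive_continuous _ _ _ (h 0)).
- by move=> x _; rewrite derive1E; have [_ ->] := dH x.
Unshelve. all: by end_near.
Qed.

Lemma measurable_expR_norm : measurable_fun setT (fun s : R => expR (- (eps * `|s|))).
Proof.
apply: continuous_measurable_fun => x.
apply: continuous_comp; last exact: continuous_expR.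
apply: cvgN; apply: cvgM; [exact: cvg_cst|exact: norm_continuous].
Qed.

Lemma integral_expR_norm :
  (\int[mu]_s (expR (- (eps * `|s|)))%:E = (2 / eps)%:E)%E.
Proof.
have := integral_expR_cos1 0.
under eq_integral => s _ do rewrite mul0r cos0 mulrC EFinM.
have me := measurable_expR_norm.
rewrite ge0_integralZl//; last by apply/measurable_EFinP.
move=> H; rewrite -[LHS]mul1e.
have -> : (1%:E = (1 + 1)^-1%:E * (1 + 1)%:E :> \bar R)%E.
  by rewrite -EFinM; congr EFin; field.
rewrite -muleA H -EFinM; congr EFin; rewrite expr0n/= addr0.
by field; rewrite gt_eqF.
Qed.

Lemma integrable_expR_norm : mu.-integrable setT (EFin \o (fun s : R => expR (- (eps * `|s|)))).
Proof.
apply: (@integrable_le_bound _ _ (2 / eps)); first exact: measurable_expR_norm.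
under eq_integral => s _ do rewrite ger0_norm ?expR_ge0//.
by rewrite integral_expR_norm.
Qed.

(** The cosine integral is the difference of the previous one and of the integral
    of the exponential; the result is the Poisson kernel. *)
Lemma Rintegral_expR_cos (u : R) :
  \int[mu]_s (expR (- (eps * `|s|)) * cos (u * s)) = 2 * eps / (eps ^+ 2 + u ^+ 2).
Proof.
have D0 : 0 < eps ^+ 2 + u ^+ 2 by rewrite ltr_pwDl ?exprn_gt0 ?sqr_ge0.
have mc : measurable_fun setT (fun s : R => cos (u * s)).
  apply: continuous_measurable_fun => s.
  apply: continuous_comp; last exact: continuous_cos.
  by apply: cvgM; [exact: cvg_cst|exact: cvg_id].
have i2 : mu.-integrable setT (EFin \o (fun s : R => expR (- (eps * `|s|)) * (1 + cos (u * s)))).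
  apply: (@integrable_le_bound _ _ (2 * (eps^-1 + eps / (eps ^+ 2 + u ^+ 2)))).
    apply: measurable_funM; first exact: measurable_expR_norm.
    exact: measurable_funD.
  under eq_integral => s _.
    rewrite ger0_norm; last first.
      by rewrite mulr_ge0 ?expR_ge0//; have := cos_geN1 (u * s); lra.
    over.
  by rewrite integral_expR_cos1.
under eq_Rintegral => s _.
  rewrite (_ : _ * _ = expR (- (eps * `|s|)) * (1 + cos (u * s)) - expR (- (eps * `|s|))); last by ring.
  over.
rewrite RintegralB//; last exact: integrable_expR_norm.
rewrite /Rintegral integral_expR_cos1 integral_expR_norm /=.
by field; rewrite !gt_eqF.
Qed.

End eps.
End AbelTransform.

(** * Fourier inversion by Abel summation *)

Section Inversion.
Context {R : realType}.
Local Notation mu := (@lebesgue_measure R).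

Lemma Rfubini (f : R * R -> R) :
  (mu \x mu)%E.-integrable setT (EFin \o f) ->
  (forall x, mu.-integrable setT (EFin \o (fun y => f (x, y)))) ->
  (forall y, mu.-integrable setT (EFin \o (fun x => f (x, y)))) ->
  \int[mu]_x \int[mu]_y f (x, y) = \int[mu]_y \int[mu]_x f (x, y).
Proof.
move=> fi f1 f2; congr fine.
transitivity (\int[mu]_x \int[mu]_y (EFin \o f) (x, y))%E.
  by apply: eq_integral => x _; rewrite fineK//; exact: integrable_fin_num (f1 x).
rewrite (Fubini fi).
by apply: eq_integral => x _; rewrite fineK//; exact: integrable_fin_num (f2 x).
Qed.

Lemma integrable_mull (p g : R -> R) (M : R) : measurable_fun setT g ->
  (forall x, `|g x| <= M) -> mu.-integrable setT (EFin \o p) ->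
  mu.-integrable setT (EFin \o (fun x => p x * g x)).
Proof.
move=> mg gM pi.
have [/measurable_EFinP mp _] := integrableP _ _ _ pi.
apply: (@le_integrableT _ _ (fun x => M * `|p x|)); first exact: measurable_funM.
  by move=> x; rewrite normrM mulrC ler_wpM2r.
exact: (integrableZl measurableT M (integrable_norm pi)).
Qed.

Lemma measurable_cos_lin (a b : R) : measurable_fun setT (fun s : R => cos (a * s + b)).
Proof.
apply: continuous_measurable_fun => s.
apply: continuous_comp; last exact: continuous_cos.
apply: cvgD; last exact: cvg_cst.
by apply: cvgM; [exact: cvg_cst|exact: cvg_id].
Qed.

Lemma normr_cos_le1 (x : R) : `|cos x| <= 1.
Proof. by rewrite ler_norml cos_geN1 cos_le1. Qed.

Lemma measurable_fun_fst d1 d2 (T1 : measurableType d1) (T2 : measurableType d2)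
  (g : T1 -> R) : measurable_fun setT g -> measurable_fun setT (fun z : T1 * T2 => g z.1).
Proof. by move=> mg; exact: (measurableT_comp mg measurable_fst). Qed.

Lemma measurable_fun_snd d1 d2 (T1 : measurableType d1) (T2 : measurableType d2)
  (g : T2 -> R) : measurable_fun setT g -> measurable_fun setT (fun z : T1 * T2 => g z.2).
Proof. by move=> mg; exact: (measurableT_comp mg measurable_snd). Qed.

Section pointwise.
Variables (p : R -> R) (t M : R).
Hypotheses (pint : mu.-integrable setT (EFin \o p)) (pM : forall x, `|p x| <= M).
Hypothesis (pt : {for t, continuous p}).

Let C s := \int[mu]_x (p x * cos (2 * pi * (x - t) * s)).
Hypothesis Cint : mu.-integrable setT (EFin \o C).

(* I eps is the inversion integral with the Abel multiplier, P eps the Poisson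
   kernel centred at t *)
Let I (eps : R) := \int[mu]_s (C s * expR (- (eps * `|s|))).
Let P (eps x : R) := 2 * eps / (eps ^+ 2 + (2 * pi * (x - t)) ^+ 2).

Let mp : measurable_fun setT p.
Proof. by have [/measurable_EFinP] := integrableP _ _ _ pint. Qed.

Let abelE eps : 0 < eps -> I eps = \int[mu]_x (p x * P eps x).
Proof.
move=> eps0.
have mc : measurable_fun setT (fun z : R * R => cos (2 * pi * (z.2 - t) * z.1)).
  apply: (@measurableT_comp _ _ _ _ _ _ cos).
    by apply: continuous_measurable_fun; exact: continuous_cos.
  apply: measurable_funM; last exact: measurable_fst.
  apply: measurable_funM => //; apply: measurable_funB => //; exact: measurable_snd.
pose f (z : R * R) := expR (- (eps * `|z.1|)) * p z.2 * cos (2 * pi * (z.2 - t) * z.1).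
have ei := integrable_expR_norm eps0.
have me := measurable_expR_norm eps.
have mf : measurable_fun setT f.
  apply: measurable_funM => //; apply: measurable_funM.
    exact: (measurable_fun_fst me).
  exact: (measurable_fun_snd mp).
have mcx x : measurable_fun setT (fun y : R => cos (2 * pi * (y - t) * x)).
  rewrite (_ : (fun _ => _) = (fun y => cos (2 * pi * x * y + - (2 * pi * t * x)))).
    exact: measurable_cos_lin.
  by apply/funext => y; congr cos; ring.
have mcy y : measurable_fun setT (fun x : R => cos (2 * pi * (y - t) * x)).
  rewrite (_ : (fun _ => _) = (fun x => cos (2 * pi * (y - t) * x + 0))).
    exact: measurable_cos_lin.
  by apply/funext => x; rewrite addr0.
have pcx x : mu.-integrable setT (EFin \o (fun y => p y * cos (2 * pi * (y - t) * x))).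
  by apply: (@integrable_mull _ _ 1) => // y; exact: normr_cos_le1.
rewrite /I; transitivity (\int[mu]_x \int[mu]_y f (x, y)).
  apply: eq_Rintegral => x _; rewrite /C mulrC -RintegralZl//.
  by apply: eq_Rintegral => y _; rewrite /f /= mulrA.
rewrite Rfubini.
- apply: eq_Rintegral => y _; rewrite /P -(Rintegral_expR_cos eps0) -RintegralZl//.
    by apply: eq_Rintegral => x _; rewrite /f /=; ring.
  by apply: (@integrable_mull _ _ 1) => // x; exact: normr_cos_le1.
- apply: le_integrable (integrable_prod ei pint) => //; first exact/measurable_EFinP.
  move=> z _ /=; rewrite lee_fin /f normrM -[leRHS]mulr1 ler_wpM2l//.
  exact: normr_cos_le1.
- move=> x; rewrite /f /=.
  rewrite (_ : (fun _ => _) = (fun y => expR (- (eps * `|x|)) * (p y * cos (2 * pi * (y - t) * x)))).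
    exact: (integrableZl measurableT (expR (- (eps * `|x|))) (pcx x)).
  by apply/funext => y; rewrite mulrA.
- move=> y; rewrite /f /=.
  rewrite (_ : (fun _ => _) = (fun x => p y * (expR (- (eps * `|x|)) * cos (2 * pi * (y - t) * x)))).
    have := (@integrable_mull _ _ 1 (mcy y) (fun x => normr_cos_le1 _) ei).
    exact: (integrableZl measurableT (p y)).
  by apply/funext => x; ring.
Qed.

Let PE eps x : 0 < eps -> P eps x = pi^-1 * lorentz (2 * pi / eps) t x.
Proof.
move=> e0; have p0 : 0 < pi :> R by exact: pi_gt0.
rewrite /P /lorentz; move: pi p0 => q q0; field.
have h1 : 0 < eps ^+ 2 + (2 * q * (x - t)) ^+ 2.
  by rewrite ltr_pwDl ?exprn_gt0 ?sqr_ge0.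
by rewrite !gt_eqF.
Qed.

Let intP eps : 0 < eps -> \int[mu]_x P eps x = 1 /\
  mu.-integrable setT (EFin \o P eps).
Proof.
move=> e0; have p0 : 0 < pi :> R by exact: pi_gt0.
have c0 : 0 < 2 * pi / eps by rewrite divr_gt0 ?mulr_gt0.
have -> : P eps = fun x => pi^-1 * lorentz (2 * pi / eps) t x.
  by apply/funext => x; exact: PE.
have li := integrable_lorentz t (ltW c0).
split; last exact: (integrableZl measurableT pi^-1 li).
rewrite RintegralZl// /Rintegral integral_lorentz//=.
by rewrite mulVf// gt_eqF.
Qed.

Let P_ge0 eps x : 0 < eps -> 0 <= P eps x.
Proof. by move=> e0; rewrite divr_ge0 ?mulr_ge0 ?addr_ge0 ?sqr_ge0 ?(ltW e0). Qed.

(** Away from t the Poisson kernel is at most eps times a fixed integrable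
    function, and near t the function p is within eta of p t. *)
Let approx eta : 0 < eta -> exists K, forall eps, 0 < eps ->
  `|I eps - p t| <= eta + eps * K.
Proof.
move=> eta0; move/cvgrPdist_le : (pt) => /(_ _ eta0) /nbhs_ballP[d /= d0 dp].
have M0 : 0 <= M by rewrite (le_trans _ (pM 0)).
pose c := (1 + d ^- 2) * (2 * M).
have c0 : 0 <= c by rewrite mulr_ge0 ?mulr_ge0// addr_ge0// invr_ge0 sqr_ge0.
exists (c * pi) => eps e0; rewrite abelE//.
have [P1 Pi] := intP e0.
have li := @integrable_lorentz R 1 t ler01.
have bd x : `|(p x - p t) * P eps x| <= eta * P eps x + eps * c * lorentz 1 t x.
  have Pg := P_ge0 x e0.
  rewrite normrM [X in _ * X]ger0_norm//.
  have [xd|dx] := ltP `|t - x| d.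
    rewrite ler_wpDr//.
      by apply: mulr_ge0; rewrite ?lorentz_ge0// mulr_ge0// (ltW e0).
    by rewrite ler_wpM2r// distrC; exact: dp.
  apply: ler_wpDl; first by apply: (mulr_ge0 _ Pg); exact: ltW.
  have p2M : `|p x - p t| <= 2 * M.
    by rewrite (le_trans (ler_normB _ _))// mulr_natl mulr2n lerD.
  apply: (@le_trans _ _ (2 * M * P eps x)); first exact: ler_wpM2r.
  rewrite /c [leRHS](_ : _ = 2 * M * (eps * (1 + d ^- 2) * lorentz 1 t x)); last by ring.
  rewrite ler_wpM2l ?mulr_ge0//.
  have v2 : d ^+ 2 <= (x - t) ^+ 2.
    by rewrite -[leRHS]real_normK ?num_real// distrC ler_sqr ?nnegrE// ltW.
  rewrite /P /lorentz mul1r.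
  have pi1 : 1 <= pi :> R by have := pi_ge2 R; lra.
  set v := (x - t) in v2 *.
  have vpi : v ^+ 2 * 4 <= (2 * pi * v) ^+ 2.
    rewrite [leRHS](_ : _ = v ^+ 2 * (4 * pi ^+ 2)); last by ring.
    rewrite ler_wpM2l ?sqr_ge0// ler_peMr// expr_ge1//; lra.
  have q0 : 0 < eps ^+ 2 + (2 * pi * v) ^+ 2 by rewrite ltr_pwDl ?exprn_gt0 ?sqr_ge0.
  rewrite mul1r ler_pdivrMr// mulrAC ler_pdivlMr ?onepsqr_gt0//.
  rewrite [leLHS](_ : _ = eps * (2 * (1 + v ^+ 2))); last by ring.
  rewrite -[leRHS]mulrA; apply: ler_wpM2l; first exact: ltW.
  have d2 : 0 < d ^+ 2 by rewrite exprn_gt0.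
  have q1 : 1 <= d ^- 2 * v ^+ 2 by rewrite mulrC ler_pdivlMr// mul1r.
  have e2 : 0 <= eps ^+ 2 by rewrite sqr_ge0.
  apply: (@le_trans _ _ ((1 + d ^- 2) * (v ^+ 2 * 4))).
    by rewrite mulrDl mul1r mulrA; have := sqr_ge0 v; lra.
  rewrite ler_wpM2l//; first by rewrite addr_ge0// invr_ge0 sqr_ge0.
  lra.
have mP : measurable_fun setT (P eps).
  by have [/measurable_EFinP] := integrableP _ _ _ Pi.
have pPi : mu.-integrable setT (EFin \o (fun x => p x * P eps x)).
  apply: (@le_integrableT _ _ (fun x => M * P eps x)).
  - exact: measurable_funM.
  - by move=> x; rewrite normrM [X in _ * X]ger0_norm ?P_ge0// ler_wpM2r// P_ge0.
  - exact: (integrableZl measurableT M Pi).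
have ptPi : mu.-integrable setT (EFin \o (fun x => p t * P eps x)).
  exact: (integrableZl measurableT (p t) Pi).
have -> : p t = \int[mu]_x (p t * P eps x) by rewrite RintegralZl// P1 mulr1.
rewrite -RintegralB//.
have di : mu.-integrable setT (EFin \o (fun x => p x * P eps x - p t * P eps x)).
  exact: (integrableB measurableT pPi ptPi).
rewrite (le_trans (le_normr_Rintegral _ di))//.
have Pi' := integrableZl measurableT eta Pi.
have li' := integrableZl measurableT (eps * c) li.
apply: (@le_trans _ _ (\int[mu]_x (eta * P eps x + eps * c * lorentz 1 t x))).
  apply: le_Rintegral => //.
  - exact: (integrable_norm di).
  - exact: (integrableD measurableT Pi' li').
  - by move=> x _; rewrite -mulrBl.
rewrite (@RintegralD _ _ _ mu setT (fun x => eta * P eps x)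
  (fun x => eps * c * lorentz 1 t x) measurableT Pi' li').
rewrite (RintegralZl eta measurableT Pi) (RintegralZl (eps * c) measurableT li) P1 mulr1.
by rewrite [X in _ * X](_ : _ = pi) ?mulrA// /Rintegral integral_lorentz.
Qed.

(** By dominated convergence the Abel means of the inversion integral tend to it,
    and by the previous bound they tend to p t. *)
Lemma cos_inversion : \int[mu]_s C s = p t.
Proof.
pose en n : R := n.+1%:R^-1.
have en0 n : 0 < en n by rewrite invr_gt0.
have en_cvg : en n @[n --> \oo] --> 0 by exact: cvg_harmonic.
have IC : I (en n) @[n --> \oo] --> \int[mu]_s C s.
  have mC : measurable_fun setT C.
    by have [/measurable_EFinP] := integrableP _ _ _ Cint.
  have [|||||_ _] := @dominated_convergence _ _ R mu setT measurableT
    (fun n s => (C s * expR (- (en n * `|s|)))%:E) (EFin \o C) (abse \o EFin \o C).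
  - move=> n; apply/measurable_EFinP; apply: measurable_funM => //.
    exact: measurable_expR_norm.
  - exact/measurable_EFinP.
  - apply: aeW => s _.
    rewrite (_ : (EFin \o C) s = (C s * expR (- (0 * `|s|)))%:E); last first.
      by rewrite mul0r oppr0 expR0 mulr1.
    apply: cvg_EFin; first exact: nearW.
    apply: (@cvgM _ _ _ _ (fun=> C s)); first exact: cvg_cst.
    apply: continuous_cvg; first exact: continuous_expR.
    by apply: cvgN; apply: cvgM => //; exact: cvg_cst.
  - exact: integrable_abse.
  - apply: aeW => s n _ /=; rewrite lee_fin normrM -[leRHS]mulr1 ler_wpM2l//.
    rewrite ger0_norm ?expR_ge0// -expR0 ler_expR oppr_le0.
    by rewrite mulr_ge0// (ltW (en0 n)).
  by rewrite -(fineK (integrable_fin_num measurableT Cint)) => /fine_cvgP[_].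
have Ip : I (en n) @[n --> \oo] --> p t.
  apply/cvgrPdist_le => e e0.
  have e20 : 0 < e / 2 by rewrite divr_gt0.
  have [K HK] := approx e20.
  have : en n * K @[n --> \oo] --> 0 * K by apply: cvgM => //; exact: cvg_cst.
  rewrite mul0r => /cvgrPdist_le /(_ _ e20) H.
  near=> n; rewrite distrC (le_trans (HK _ (en0 n)))//.
  have : `|0 - en n * K| <= e / 2 by near: n.
  rewrite sub0r normrN ler_norml => /andP[_ ?]; lra.
exact: (cvg_unique _ IC Ip).
Unshelve. all: by end_near.
Qed.

End pointwise.
End Inversion.

(** * Complex-valued functions by real and imaginary parts *)

Section ComplexFunctions.
Local Open Scope complex_scope.
Local Open Scope ring_scope.
Context {R : realType}.
Local Notation mu := (@lebesgue_measure R).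
Implicit Types (z u : R[i]).

Lemma ReM z u : complex.Re (z * u) = complex.Re z * complex.Re u - complex.Im z * complex.Im u.
Proof. by case: z u => a b [c d]. Qed.

Lemma ImM z u : complex.Im (z * u) = complex.Re z * complex.Im u + complex.Im z * complex.Re u.
Proof. by case: z u => a b [c d]. Qed.

Lemma Re_conj z : complex.Re (z^*) = complex.Re z.
Proof. by case: z. Qed.

Lemma Im_conj z : complex.Im (z^*) = - complex.Im z.
Proof. by case: z. Qed.

Lemma eq_complexP z u : complex.Re z = complex.Re u -> complex.Im z = complex.Im u -> z = u.
Proof. by case: z u => a b [c d] /= -> ->. Qed.

Lemma expiD (a b : R) : expi (a + b) = expi a * expi b.
Proof. by apply: eq_complexP; rewrite ?ReM ?ImM /= ?cosD ?sinD //; ring. Qed.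

Lemma conj_expi (a : R) : (expi a)^* = expi (- a).
Proof. by apply: eq_complexP; rewrite ?Re_conj ?Im_conj /= ?cosN ?sinN. Qed.

(** The l^1 modulus is equivalent to the usual one and, unlike it, is a sum of
    terms for the real and the imaginary part, which are integrated separately. *)
Definition norm1 z : R := `|complex.Re z| + `|complex.Im z|.

Lemma norm1_ge0 z : 0 <= norm1 z.
Proof. by rewrite addr_ge0. Qed.

Lemma norm1M z u : norm1 (z * u) <= norm1 z * norm1 u.
Proof.
rewrite /norm1 ReM ImM.
rewrite (le_trans (lerD (ler_normB _ _) (ler_normD _ _)))// !normrM.
by rewrite le_eqVlt; apply/orP; left; apply/eqP; ring.
Qed.

Lemma norm1_conj z : norm1 (z^*) = norm1 z.
Proof. by rewrite /norm1 Re_conj Im_conj normrN. Qed.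

Lemma norm1_expi (a : R) : norm1 (expi a) <= 2.
Proof.
rewrite /norm1 /= -[leRHS]/(1 + 1 : R) lerD//.
  exact: normr_cos_le1.
by rewrite ler_norml sin_geN1 sin_le1.
Qed.

Lemma Re_le_norm1 z : `|complex.Re z| <= norm1 z.
Proof. by rewrite /norm1 lerDl. Qed.

Lemma Im_le_norm1 z : `|complex.Im z| <= norm1 z.
Proof. by rewrite /norm1 lerDr. Qed.

Lemma normc_le_norm1 z : Normc.normc z <= norm1 z.
Proof.
case: z => a b; rewrite /Normc.normc /norm1 /=.
rewrite -(@ler_pXn2r _ 2) ?nnegrE ?sqrtr_ge0 ?addr_ge0//.
rewrite sqr_sqrtr ?addr_ge0 ?sqr_ge0// sqrrD !real_normK ?num_real//.
by rewrite lerD2r lerDl mulrn_wge0// mulr_ge0.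
Qed.

Section measurability.
Context d (T : measurableType d).
Implicit Types f g : T -> R[i].

Definition cmeasurable f := measurable_fun setT (fun x => complex.Re (f x)) /\
  measurable_fun setT (fun x => complex.Im (f x)).

Lemma cmeasurableM f g : cmeasurable f -> cmeasurable g ->
  cmeasurable (fun x => f x * g x).
Proof.
move=> [fr fi] [gr gi]; split.
  under eq_fun do rewrite ReM.
  by apply: measurable_funB; apply: measurable_funM.
under eq_fun do rewrite ImM.
by apply: measurable_funD; apply: measurable_funM.
Qed.

Lemma cmeasurable_conj f : cmeasurable f -> cmeasurable (fun x => (f x)^*).
Proof.
move=> [fr fi]; split.
  by under eq_fun do rewrite Re_conj.
under eq_fun do rewrite Im_conj.
exact: measurableT_comp.
Qed.

Lemma cmeasurable_expi (a : T -> R) : measurable_fun setT a ->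
  cmeasurable (fun x => expi (a x)).
Proof.
move=> ma; split => /=.
  apply: (@measurableT_comp _ _ _ _ _ _ cos) => //.
  by apply: continuous_measurable_fun; exact: continuous_cos.
apply: (@measurableT_comp _ _ _ _ _ _ sin) => //.
by apply: continuous_measurable_fun; exact: continuous_sin.
Qed.

Lemma cmeasurable_real (a : T -> R) : measurable_fun setT a ->
  cmeasurable (fun x => (a x)%:C).
Proof. by move=> ma; split. Qed.

Lemma measurable_normc f : cmeasurable f ->
  measurable_fun setT (fun x => Normc.normc (f x)).
Proof.
move=> [fr fi].
rewrite (_ : (fun _ => _) = (fun x => Num.sqrt
   (complex.Re (f x) ^+ 2 + complex.Im (f x) ^+ 2))).
  have ms : measurable_fun setT (Num.sqrt : R -> R).
    by apply: continuous_measurable_fun; exact: sqrt_continuous.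
  by apply: (measurableT_comp ms); apply: measurable_funD; apply: measurable_funX.
by apply/funext => x; case: (f x).
Qed.

Lemma cmeasurable_cintegral (f : T * R -> R[i]) :
  measurable_fun setT (fun x => complex.Re (f x)) ->
  measurable_fun setT (fun x => complex.Im (f x)) ->
  cmeasurable (fun x => cintegral (fun t => f (x, t))).
Proof.
move=> fr fi; split => /=.
  exact: (measurable_Rintegral fr).
exact: (measurable_Rintegral fi).
Qed.

End measurability.

Lemma cmeasurable_comp d1 d2 (T1 : measurableType d1) (T2 : measurableType d2)
  (f : T2 -> R[i]) (h : T1 -> T2) : measurable_fun setT h -> cmeasurable f ->
  cmeasurable (f \o h).
Proof.
by move=> mh [fr fi]; split; [exact: (measurableT_comp fr mh)|exact: (measurableT_comp fi mh)].
Qed.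

Implicit Types f g : R -> R[i].

Definition cintegrable f := mu.-integrable setT (EFin \o (fun x => complex.Re (f x))) /\
  mu.-integrable setT (EFin \o (fun x => complex.Im (f x))).

Lemma cintegrable_measurable f : cintegrable f -> cmeasurable f.
Proof.
move=> [/integrableP[/measurable_EFinP fr _] /integrableP[/measurable_EFinP fi _]].
by split.
Qed.

Lemma le_cintegrable f (a : R -> R) : cmeasurable f ->
  (forall x, norm1 (f x) <= a x) -> mu.-integrable setT (EFin \o a) -> cintegrable f.
Proof.
move=> [fr fi] fa ai; split; apply: le_integrableT ai => // x.
  by rewrite (le_trans (Re_le_norm1 _)).
by rewrite (le_trans (Im_le_norm1 _)).
Qed.

Lemma integrable_norm1 f : cintegrable f -> mu.-integrable setT (EFin \o (fun x => norm1 (f x))).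
Proof.
move=> [fr fi].
exact: (integrableD measurableT (integrable_norm fr) (integrable_norm fi)).
Qed.

Lemma cintegrable_conj f : cintegrable f -> cintegrable (fun x => (f x)^*).
Proof.
move=> fi; apply: (@le_cintegrable _ (fun x => norm1 (f x))).
- by apply: cmeasurable_conj; exact: cintegrable_measurable.
- by move=> x; rewrite norm1_conj.
- exact: integrable_norm1.
Qed.

Lemma eq_cintegral f g : f =1 g -> cintegral f = cintegral g.
Proof. by move=> fg; congr cintegral; apply/funext. Qed.

Lemma cintegral0 : cintegral (fun=> 0 : R[i]) = 0.
Proof. by apply: eq_complexP => /=; rewrite Rintegral_cst// mul0r. Qed.

Lemma cintegral_conj f : cintegrable f -> (cintegral f)^* = cintegral (fun x => (f x)^*).
Proof.
move=> [fr fi]; apply: eq_complexP; rewrite ?Re_conj ?Im_conj /=.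
  by under [RHS]eq_Rintegral do rewrite Re_conj.
under [RHS]eq_Rintegral do rewrite Im_conj -mulN1r.
by rewrite RintegralZl// mulN1r.
Qed.

Lemma cintegralZl (c : R[i]) f : cintegrable f ->
  cintegral (fun x => c * f x) = c * cintegral f.
Proof.
move=> [fr fi].
have Z (a : R) (h : R -> R) : mu.-integrable setT (EFin \o h) ->
    mu.-integrable setT (EFin \o (fun x => a * h x)).
  by move=> hi; exact: (integrableZl measurableT a hi).
apply: eq_complexP; rewrite ?ReM ?ImM /=.
  under eq_Rintegral do rewrite ReM.
  by rewrite RintegralB ?RintegralZl//; exact: Z.
under eq_Rintegral do rewrite ImM.
by rewrite RintegralD ?RintegralZl//; exact: Z.
Qed.

Lemma cintegral_shift f c : cmeasurable f ->
  cintegral (fun x => f (x - c)) = cintegral f.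
Proof.
move=> [fr fi]; apply: eq_complexP => /=.
  exact: (@Rintegral_shift _ (fun x => complex.Re (f x))).
exact: (@Rintegral_shift _ (fun x => complex.Im (f x))).
Qed.

(** A product majorant gives at once integrability on the plane and along every
    section, so that all the iterated integrals are finite everywhere. *)
Lemma cfubini (Phi : R * R -> R[i]) (a b : R -> R) : cmeasurable Phi ->
  mu.-integrable setT (EFin \o a) -> mu.-integrable setT (EFin \o b) ->
  (forall s t, norm1 (Phi (s, t)) <= a s * b t) ->
  cintegral (fun s => cintegral (fun t => Phi (s, t))) =
  cintegral (fun t => cintegral (fun s => Phi (s, t))).
Proof.
move=> [Pr Pi] ai bi Pab.
have H (h : R[i] -> R) : measurable_fun setT (h \o Phi) ->
    (forall z, `|h z| <= norm1 z) ->
    \int[mu]_s \int[mu]_t h (Phi (s, t)) = \int[mu]_t \int[mu]_s h (Phi (s, t)).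
  move=> mh hn; apply: (@Rfubini _ (h \o Phi)).
  - apply: le_integrable (integrable_prod ai bi) => //; first exact/measurable_EFinP.
    move=> [s t] _ /=; rewrite lee_fin (le_trans (hn _))// (le_trans (Pab _ _))//.
    exact: ler_norm.
  - move=> s; apply: (@le_integrableT _ _ (fun t => a s * b t)).
    + exact: (measurableT_comp mh (pair1_measurable s)).
    + by move=> t; rewrite (le_trans (hn _)).
    + exact: (integrableZl measurableT (a s) bi).
  - move=> t; apply: (@le_integrableT _ _ (fun s => b t * a s)).
    + exact: (measurableT_comp mh (pair2_measurable t)).
    + by move=> s; rewrite (le_trans (hn _))// mulrC.
    + exact: (integrableZl measurableT (b t) ai).
by apply: eq_complexP => /=; apply: H => // z; [exact: Re_le_norm1|exact: Im_le_norm1].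
Qed.

End ComplexFunctions.

(** * Fourier inversion and Parseval's identity for complex functions *)

Section Parseval.
Local Open Scope complex_scope.
Local Open Scope ring_scope.
Context {R : realType}.
Local Notation mu := (@lebesgue_measure R).

(** The phase al covers the cosine (0) and the sine (- pi / 2) transforms, and a
    change of origin in t. *)
Definition osc_integral (p : R -> R) (al s : R) : R := \int[mu]_t (p t * cos (2 * pi * t * s + al)).

(** Inversion needs an integrable bounded function with integrable transform; the
    decay of order s^-2, uniform in the phase, gives the latter together with its
    sine counterpart. *)
Definition fourier_nice (p : R -> R) :=
  [/\ mu.-integrable setT (EFin \o p), exists M, forall x, `|p x| <= M &
      exists c, forall s al, `|osc_integral p al s| <= c * lorentz 1 0 s].

Section real.
Variable (p : R -> R).
Hypothesis np : fourier_nice p.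

Let pint : mu.-integrable setT (EFin \o p). Proof. by case: np. Qed.
Let mp : measurable_fun setT p.
Proof. by have [/measurable_EFinP] := integrableP _ _ _ pint. Qed.

Lemma integrable_osc_integral (al : R -> R) : measurable_fun setT al ->
  mu.-integrable setT (EFin \o (fun s => osc_integral p (al s) s)).
Proof.
move=> mal; have [_ _ [c oc]] := np.
apply: (@le_integrableT _ _ (fun s => c * lorentz 1 0 s)).
- apply: (@measurable_Rintegral _ _ _ (fun z : R * R => p z.2 * cos (2 * pi * z.2 * z.1 + al z.1))).
  apply: measurable_funM; first exact: (measurable_fun_snd mp).
  apply: (@measurableT_comp _ _ _ _ _ _ cos).
    by apply: continuous_measurable_fun; exact: continuous_cos.
  apply: measurable_funD; last exact: (measurable_fun_fst mal).
  apply: measurable_funM; last exact: measurable_fst.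
  by apply: measurable_funM => //; exact: measurable_snd.
- by move=> s; exact: oc.
- exact: (integrableZl measurableT c (integrable_lorentz 0 ler01)).
Qed.

Let linm (a b : R) : measurable_fun setT (fun s : R => a * s + b).
Proof. by apply: measurable_funD => //; apply: measurable_funM. Qed.

Let cosE (t : R) : (fun s => \int[mu]_x (p x * cos (2 * pi * (x - t) * s))) =
  (fun s => osc_integral p (- (2 * pi * t) * s + 0) s).
Proof.
apply/funext => s; apply: eq_Rintegral => x _; congr (_ * cos _); ring.
Qed.

Let sinE (t : R) : (fun s => \int[mu]_x (p x * sin (2 * pi * (x - t) * s))) =
  (fun s => osc_integral p (- (2 * pi * t) * s - pi / 2) s).
Proof.
apply/funext => s; apply: eq_Rintegral => x _; rewrite -cosBpihalf.
by congr (_ * cos _); move: pi => q; ring.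
Qed.

Lemma integrable_cos_transform t :
  mu.-integrable setT (EFin \o (fun s => \int[mu]_x (p x * cos (2 * pi * (x - t) * s)))).
Proof. by rewrite cosE; apply: integrable_osc_integral; exact: linm. Qed.

Lemma integrable_sin_transform t :
  mu.-integrable setT (EFin \o (fun s => \int[mu]_x (p x * sin (2 * pi * (x - t) * s)))).
Proof. by rewrite sinE; apply: integrable_osc_integral; exact: linm. Qed.

Lemma cos_inversion_nice t : {for t, continuous p} ->
  \int[mu]_s \int[mu]_x (p x * cos (2 * pi * (x - t) * s)) = p t.
Proof.
move=> pt; have [_ [M pM] _] := np.
exact: (cos_inversion pint pM pt (integrable_cos_transform t)).
Qed.

(** The sine transform is odd in s. *)
Lemma sin_inversion_nice t :
  \int[mu]_s \int[mu]_x (p x * sin (2 * pi * (x - t) * s)) = 0.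
Proof.
have Si := integrable_sin_transform t.
have [/measurable_EFinP mS _] := integrableP _ _ _ Si.
set S := (fun s => _) in Si mS *.
have SN s : S (- s) = - 1 * S s.
  rewrite /S -RintegralZl//.
    by apply: eq_Rintegral => x _; rewrite mulrN sinN mulrN mulN1r.
  apply: (@integrable_mull _ _ _ 1) => //.
    apply: (@measurableT_comp _ _ _ _ _ _ sin).
      by apply: continuous_measurable_fun; exact: continuous_sin.
    by apply: measurable_funM => //; apply: measurable_funM => //; apply: measurable_funB.
  by move=> x; rewrite ler_norml sin_geN1 sin_le1.
have := RintegralNx mS.
under eq_Rintegral do rewrite SN.
rewrite RintegralZl// mulN1r => H.
have : \int[mu]_s S s + \int[mu]_s S s = 0 by rewrite -{1}H addNr.
by rewrite -mulr2n => /eqP; rewrite mulrn_eq0 /= => /eqP.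
Qed.

End real.

Definition cfourier_nice (f : R -> R[i]) :=
  fourier_nice (fun x => complex.Re (f x)) /\ fourier_nice (fun x => complex.Im (f x)).

Lemma cfourier_nice_integrable f : cfourier_nice f -> cintegrable f.
Proof. by move=> [[fr _ _] [fi _ _]]. Qed.

Lemma norm1_mul_expi (z : R[i]) (a : R) : norm1 (z * expi a) <= 2 * norm1 z.
Proof.
by rewrite mulrC (le_trans (norm1M _ _))// ler_wpM2r ?norm1_ge0// norm1_expi.
Qed.

Lemma cintegrable_mul_expi (f : R -> R[i]) (a : R -> R) : measurable_fun setT a ->
  cintegrable f -> cintegrable (fun x => f x * expi (a x)).
Proof.
move=> ma fi; apply: (@le_cintegrable _ _ (fun x => 2 * norm1 (f x))).
- by apply: cmeasurableM; [exact: cintegrable_measurable|exact: cmeasurable_expi].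
- by move=> x; exact: norm1_mul_expi.
- exact: (integrableZl measurableT 2 (integrable_norm1 fi)).
Qed.

Section shifted.
Variable (f : R -> R[i]) (t : R).
Hypothesis nf : cfourier_nice f.

Let H s := cintegral (fun x => f x * expi (2 * pi * (x - t) * s)).

Let mlin s : measurable_fun setT (fun x : R => 2 * pi * (x - t) * s).
Proof.
by apply: measurable_funM => //; apply: measurable_funM => //; apply: measurable_funB.
Qed.

Let HE s : H s =
  (\int[mu]_x (complex.Re (f x) * cos (2 * pi * (x - t) * s)) -
   \int[mu]_x (complex.Im (f x) * sin (2 * pi * (x - t) * s))) +i*
  (\int[mu]_x (complex.Re (f x) * sin (2 * pi * (x - t) * s)) +
   \int[mu]_x (complex.Im (f x) * cos (2 * pi * (x - t) * s))).
Proof.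
have [[pr _ _] [pi' _ _]] := nf.
have ic (p : R -> R) : mu.-integrable setT (EFin \o p) ->
    mu.-integrable setT (EFin \o (fun x => p x * cos (2 * pi * (x - t) * s))).
  apply: (@integrable_mull _ _ _ 1); last by move=> x; exact: normr_cos_le1.
  by have [] := cmeasurable_expi (mlin s).
have is_ (p : R -> R) : mu.-integrable setT (EFin \o p) ->
    mu.-integrable setT (EFin \o (fun x => p x * sin (2 * pi * (x - t) * s))).
  apply: (@integrable_mull _ _ _ 1); last by move=> x; rewrite ler_norml sin_geN1 sin_le1.
  by have [] := cmeasurable_expi (mlin s).
apply: eq_complexP => /=.
  under eq_Rintegral do rewrite ReM.
  by rewrite RintegralB//; [exact: ic|exact: is_].
under eq_Rintegral do rewrite ImM.
by rewrite RintegralD//; [exact: is_|exact: ic].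
Qed.

Lemma cintegrable_shifted : cintegrable H.
Proof.
have [fr fi] := nf; split.
  under eq_fun do rewrite HE.
  exact: (integrableB measurableT (integrable_cos_transform fr t) (integrable_sin_transform fi t)).
under eq_fun do rewrite HE.
exact: (integrableD measurableT (integrable_sin_transform fr t) (integrable_cos_transform fi t)).
Qed.

(** The complex exponential splits the inversion integral into cosine terms, which
    return f t, and sine terms, which integrate to 0. *)
Lemma fourier_inversion :
  {for t, continuous (fun x => complex.Re (f x))} ->
  {for t, continuous (fun x => complex.Im (f x))} -> cintegral H = f t.
Proof.
move=> cr ci; have [fr fi] := nf.
have h1 := integrable_cos_transform fr t; have h2 := integrable_sin_transform fr t.
have h3 := integrable_cos_transform fi t; have h4 := integrable_sin_transform fi t.
apply: eq_complexP.
  transitivity (\int[mu]_s complex.Re (H s)); first by [].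
  under eq_Rintegral do rewrite HE.
  by rewrite RintegralB// cos_inversion_nice// sin_inversion_nice// subr0.
transitivity (\int[mu]_s complex.Im (H s)); first by [].
under eq_Rintegral do rewrite HE.
by rewrite RintegralD// cos_inversion_nice// sin_inversion_nice// add0r.
Qed.

End shifted.

(** Expanding the second factor as an integral over t and exchanging the order of
    integration leaves, for each t, the inversion integral of f at t.  Inversion
    is only needed where g does not vanish, so a discontinuity of f at the
    boundary of D is harmless. *)
Lemma parseval (f g : R -> R[i]) (xi om : R) : cfourier_nice f -> cintegrable g ->
  (forall t, g t = 0 \/ ({for t, continuous (fun x => complex.Re (f x))} /\
                         {for t, continuous (fun x => complex.Im (f x))})) ->
  inner (translate om (inv_fourier f)) (translate xi (inv_fourier g)) =
  cintegral (fun t => f t * (g t)^* * expi (2 * pi * t * (xi - om))).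
Proof.
move=> nf gi fg.
have fi := cfourier_nice_integrable nf.
have ffi : cintegrable (inv_fourier f).
  rewrite (_ : inv_fourier f = (fun s => cintegral (fun x => f x * expi (2 * pi * (x - 0) * s)))).
    exact: cintegrable_shifted.
  by apply/funext => s; apply: eq_cintegral => x; rewrite subr0.
have mf := cintegrable_measurable ffi; have mg := cintegrable_measurable gi.
have mlin (a b : R) : measurable_fun setT (fun s : R => a * s * b).
  by apply: measurable_funM => //; apply: measurable_funM.
have msub (c : R) : measurable_fun setT (fun s : R => s - c) by apply: measurable_funB.
pose Phi (z : R * R) := inv_fourier f (z.1 - om) *
  ((g z.2)^* * expi (- (2 * pi * z.2 * (z.1 - xi)))).
transitivity (cintegral (fun s => cintegral (fun t => Phi (s, t)))).
  apply: eq_cintegral => s; rewrite /translate cintegral_conj; last first.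
    by apply: cintegrable_mul_expi => //; exact: mlin.
  rewrite /Phi /= -cintegralZl.
    by apply: eq_cintegral => t; rewrite rmorphM /= conj_expi.
  by apply: cintegrable_conj; apply: cintegrable_mul_expi => //; exact: mlin.
rewrite (@cfubini _ _ (fun s => 2 * norm1 (inv_fourier f (s - om))) (fun t => norm1 (g t))).
- apply: eq_cintegral => t; rewrite /Phi /=.
  have [->|[cr ci]] := fg t.
    under eq_cintegral do rewrite rmorph0 mul0r mulr0.
    by rewrite rmorph0 mulr0 mul0r cintegral0.
  pose H s := cintegral (fun x => f x * expi (2 * pi * (x - t) * s)).
  have HE s : H s = inv_fourier f s * expi (- (2 * pi * t * s)).
    rewrite /H [RHS]mulrC /inv_fourier -cintegralZl.
      apply: eq_cintegral => x; rewrite [RHS]mulrC -[RHS]mulrA -expiD.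
      by congr (_ * expi _); ring.
    by apply: cintegrable_mul_expi => //; exact: mlin.
  have Hi := cintegrable_shifted t nf.
  transitivity (cintegral (fun s => ((g t)^* * expi (2 * pi * t * (xi - om))) * H (s - om))).
    apply: eq_cintegral => s; rewrite HE.
    rewrite [RHS](_ : _ = inv_fourier f (s - om) * ((g t)^* *
      (expi (2 * pi * t * (xi - om)) * expi (- (2 * pi * t * (s - om)))))); last by ring.
    by rewrite -expiD; congr (_ * (_ * expi _)); ring.
  have mH := cintegrable_measurable Hi.
  rewrite cintegralZl ?cintegral_shift ?fourier_inversion//; first by ring.
  have [Hr Hm] := Hi; split.
    exact: (@integrable_shift _ (fun s => complex.Re (H s))).
  exact: (@integrable_shift _ (fun s => complex.Im (H s))).
- apply: cmeasurableM.
    apply: (@cmeasurable_comp _ _ _ _ _ _ (fun z : R * R => z.1 - om)) => //.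
    by apply: measurable_funB => //; exact: measurable_fst.
  apply: cmeasurableM.
    apply: cmeasurable_conj; apply: (@cmeasurable_comp _ _ _ _ _ _ snd) => //.
  apply: cmeasurable_expi; apply: measurableT_comp => //.
  apply: measurable_funM.
    by apply: measurable_funM => //; exact: measurable_snd.
  by apply: measurable_funB => //; exact: measurable_fst.
- have sh := @integrable_shift _ (fun s => norm1 (inv_fourier f s)) om (integrable_norm1 ffi).
  exact: (integrableZl measurableT 2 sh).
- exact: integrable_norm1.
- move=> s t; rewrite /Phi /= (le_trans (norm1M _ _))//.
  rewrite -[leRHS]mulrA mulrCA; apply: ler_wpM2l; first exact: norm1_ge0.
  by rewrite (le_trans (norm1_mul_expi _ _))// norm1_conj.
Qed.

End Parseval.

(** * Warping functions *)

Section WarpingFacts.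
Context {R : realType} (D : set R) (F : R -> R).
Hypothesis hD : D = setT \/ D = [set x : R | 0 < x].
Hypothesis hF : warping D F.
Local Notation mu := (@lebesgue_measure R).
Local Notation phi := (warp_inv D F).
Local Notation w := (warp_weight D F).

Lemma warp_open : open D.
Proof. by case: hD => ->; [exact: openT|exact: open_gt]. Qed.

Lemma warp_between s t x : D s -> D t -> s <= x <= t -> D x.
Proof.
by case: hD => -> //= s0 t0 /andP[sx _]; exact: lt_le_trans sx.
Qed.

Lemma warp_inv_in X : D (phi X).
Proof.
have [bij _ _ _ _] := hF.
have [h _ _] := bijpinv_bij (fun=> point) bij.
exact: h.
Qed.

Lemma warp_invK X : F (phi X) = X.
Proof.
have [[_ _ sF] _ _ _ _] := hF.
by rewrite /warp_inv (surjpK (fun=> point) sF)// inE.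
Qed.

Lemma warpK t : D t -> phi (F t) = t.
Proof.
have [[_ inj _] _ _ _ _] := hF.
by move=> Dt; apply: inj; rewrite ?inE ?warp_invK//; exact: warp_inv_in.
Qed.

Lemma warp_is_derive t : D t -> is_derive t 1 F (derive1 F t).
Proof.
have [_ h _ _ _] := hF; move=> /h[df _].
by rewrite derive1E; exact: derivableP.
Qed.

Lemma warp_cvg t : D t -> {for t, continuous F}.
Proof. by move=> /warp_is_derive/is_derive_continuous. Qed.

Lemma warp_derive1_cvg t : D t -> {for t, continuous (derive1 F)}.
Proof. by have [_ h _ _ _] := hF => /h[]. Qed.

Lemma warp_derive1_gt0 t : D t -> 0 < derive1 F t.
Proof. by have [_ _ h _ _] := hF => /h. Qed.

Lemma warp_incr s t : D s -> D t -> s < t -> F s < F t.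
Proof.
move=> Ds Dt st.
have H x : s <= x <= t -> D x by exact: warp_between.
have [x||c] := @MVT R F (derive1 F) s t st.
- rewrite in_itv/= => /andP[sx xt]; apply: warp_is_derive; apply: H.
  by rewrite !ltW.
- apply: continuous_in_subspaceT => x /set_mem /=; rewrite in_itv => /H.
  exact: warp_cvg.
rewrite in_itv/= => /andP[sc ct] E.
rewrite -subr_gt0 E mulr_gt0 ?subr_gt0//; apply: warp_derive1_gt0; apply: H.
by rewrite !ltW.
Qed.

Lemma warp_inv_incr X Y : X < Y -> phi X < phi Y.
Proof.
move=> XY; rewrite ltNge le_eqVlt; apply/negP => /orP[/eqP E|lt].
  by move: XY; rewrite -(warp_invK X) -(warp_invK Y) E ltxx.
have := warp_incr (warp_inv_in Y) (warp_inv_in X) lt.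
by rewrite !warp_invK ltNge (ltW XY).
Qed.

(** The preimages under F of the intervals [-n-1, n+1] exhaust D; at their ends
    F takes integer values, whatever the shape of D. *)
Lemma warp_exhausts :
  exhausts D (fun n => phi (- n.+1%:R)) (fun n => phi n.+1%:R).
Proof.
have [ab nd sT] := @exhaustsT R.
have le X Y : X <= Y -> phi X <= phi Y.
  by rewrite le_eqVlt => /predU1P[->//|/warp_inv_incr/ltW].
split.
- by move=> n; apply: warp_inv_incr; exact: ab.
- move=> n m nm; apply/subsetPset => x /=; rewrite !in_itv /= => /andP[xn xm].
  have nm' : (n.+1%:R : R) <= m.+1%:R by rewrite ler_nat.
  by rewrite (le_trans _ xn) ?(le_trans xm)// le// lerN2.
- apply/seteqP; split=> x.
    move=> Dx.
    have : [set: R] (F x) by [].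
    rewrite sT => -[n _ /=]; rewrite in_itv /= => /andP[nx xn].
    by exists n => //=; rewrite in_itv /= -{1 2}(warpK Dx) !le.
  move=> [n _ /=]; rewrite in_itv /=.
  by apply: warp_between; exact: warp_inv_in.
Qed.

Lemma warp_weight_gt0 X : 0 < w X.
Proof. by have [_ _ _ _ [[v [_ h _]] _]] := hF; exact: h. Qed.

Lemma warp_weight_derive1 t : D t -> derive1 F t = (w (F t))^-1.
Proof.
move=> Dt; have oD := warp_open.
have nD : \forall x \near t, D x by exact: open_nbhs_nbhs.
have := @is_derive_inverse R F phi (derive1 F t) t.
case.
- by near=> x; apply: warpK; near: x.
- by near=> x; apply: warp_cvg; near: x.
- exact: warp_is_derive.
- by rewrite gt_eqF// warp_derive1_gt0.
- by move=> _ E; rewrite /warp_weight [X in _ = X^-1]derive1E E invrK.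
Unshelve. all: by end_near.
Qed.

(** The derivative of atan (F t - X), the universal majorant for integrals over D.
    Its integral is bounded by pi independently of F and X. *)
Definition warp_maj (X t : R) := derive1 F t / (1 + (F t - X) ^+ 2).

Lemma warp_maj_ge0 X t : D t -> 0 <= warp_maj X t.
Proof. by move=> Dt; rewrite divr_ge0 ?ltW ?warp_derive1_gt0 ?onepsqr_gt0. Qed.

Lemma warp_majE X t : D t -> warp_maj X t = (w (F t) * (1 + (F t - X) ^+ 2))^-1.
Proof. by move=> Dt; rewrite /warp_maj warp_weight_derive1// invfM. Qed.

Let is_derive_maj X t : D t ->
  is_derive t 1 (fun t => atan (F t - X)) (warp_maj X t).
Proof.
move=> Dt; have dF := warp_is_derive Dt.
have H : is_derive t 1 (fun x : R => F x - X) (derive1 F t).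
  by apply: is_derive_eq; rewrite subr0.
rewrite /warp_maj mulrC.
exact: (@is_derive1_comp _ atan (fun x => F x - X)).
Qed.

Lemma continuous_warp_maj X t : D t -> {for t, continuous (warp_maj X)}.
Proof.
move=> Dt; apply: cvgM; first exact: warp_derive1_cvg.
apply: cvgV; first by rewrite gt_eqF// onepsqr_gt0.
apply: cvgD; first exact: cvg_cst.
rewrite expr2; apply: cvgM.
all: by apply: cvgB; [exact: warp_cvg|exact: cvg_cst].
Qed.

Lemma integral_warp_maj_le X : (\int[mu]_(t in D) (warp_maj X t)%:E <= pi%:E)%E.
Proof.
rewrite [X in (_ <= X%:E)%E](_ : pi = 2 * (pi / 2)); last by field.
apply: (ge0_FTC_exhaustion_le warp_open warp_exhausts (e := fun t => atan (F t - X))).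
- by move=> t; exact: is_derive_maj.
- by move=> t; exact: continuous_warp_maj.
- by move=> t; exact: warp_maj_ge0.
- by move=> t _; exact: atan_le_pihalf.
Qed.

Lemma measurable_on_warp (f : R -> R) : (forall t, D t -> {for t, continuous f}) ->
  measurable_fun D f.
Proof.
by move=> cf; apply: (open_continuous_measurable warp_open cf).
Qed.

Lemma measurable_warp : measurable (D : set (measurableTypeR R)).
Proof. by apply: open_measurable; exact: warp_open. Qed.

Lemma integrable_warp_maj X : mu.-integrable D (EFin \o warp_maj X).
Proof.
apply/integrableP; split.
  by apply/measurable_EFinP; apply: measurable_on_warp => t; exact: continuous_warp_maj.
have -> : (\int[mu]_(t in D) `|(EFin \o warp_maj X) t|)%E =
    (\int[mu]_(t in D) (warp_maj X t)%:E)%E.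
  apply: eq_integral => t; rewrite inE => Dt.
  by rewrite /= ger0_norm// warp_maj_ge0.
by rewrite (le_lt_trans (integral_warp_maj_le _))// ltry.
Qed.

Lemma warp_dominated (f : R -> R) (c X : R) :
  (forall t, D t -> {for t, continuous f}) ->
  (forall t, D t -> `|f t| <= c * warp_maj X t) ->
  mu.-integrable D (EFin \o f) /\
  (0 <= c -> `|\int[mu]_(t in D) f t| <= c * pi).
Proof.
move=> cf fc; have mD := measurable_warp.
have mi := integrable_warp_maj X.
have cmi : mu.-integrable D (EFin \o (fun t => c * warp_maj X t)).
  exact: (integrableZl mD c mi).
have fi : mu.-integrable D (EFin \o f).
  apply: le_integrable cmi => //.
    by apply/measurable_EFinP; exact: measurable_on_warp.
  by move=> t Dt /=; rewrite lee_fin (le_trans (fc t Dt))// ler_norm.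
split => // c0; rewrite (le_trans (le_normr_Rintegral mD fi))//.
apply: (@le_trans _ _ (\int[mu]_(t in D) (c * warp_maj X t))).
  by apply: le_Rintegral => //; exact: (integrable_norm fi).
rewrite RintegralZl//; apply: ler_wpM2l => //.
rewrite -lee_fin /Rintegral fineK ?integral_warp_maj_le//.
exact: (integrable_fin_num mD mi).
Qed.

End WarpingFacts.

(** * Oscillatory integrals in a warped variable *)

Section Oscillatory.
Context {R : realType} (D : set R) (F : R -> R).
Hypothesis hD : D = setT \/ D = [set x : R | 0 < x].
Hypothesis hF : warping D F.
Local Notation mu := (@lebesgue_measure R).
Local Notation phi := (warp_inv D F).
Local Notation w := (warp_weight D F).
Hypothesis hw : C1_on setT w.
Variable (D1 : R).
Hypothesis hD1 : forall x : R, `|derive1 w x / w x| <= D1.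

Lemma warp_weight_is_derive (x : R) : is_derive x 1 w (derive1 w x).
Proof.
have [dw _] := hw (I : setT x).
by rewrite derive1E; exact: derivableP.
Qed.

Lemma continuous_warp_weight : continuous w.
Proof. by move=> x; exact: (is_derive_continuous (warp_weight_is_derive x)). Qed.

Let w0 x : 0 < w x. Proof. exact: (warp_weight_gt0 hF). Qed.

Variables (A A1 A2 : R -> R) (X al be ga : R).
Hypothesis dA : forall r : R, is_derive r 1 A (A1 r).
Hypothesis dA1 : forall r : R, is_derive r 1 A1 (A2 r).
Hypothesis cA2 : continuous A2.
Hypothesis (al0 : 0 <= al) (be0 : 0 <= be).
Hypothesis hA : forall r, `|A r| <= al / (w r * (1 + (r - X) ^+ 2)).
Hypothesis hG : forall r, `|A2 r| + D1 * `|A1 r| <= be * w r / (1 + (r - X) ^+ 2).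
Hypothesis hA0 : forall r, `|A r| <= ga / (1 + (r - X) ^+ 2).
Hypothesis hA1 : forall r, `|A1 r| / w r <= ga / (1 + (r - X) ^+ 2).

(* G is (A1 / w)' / w *)
Let G r := (A2 r - A1 r * (derive1 w r / w r)) / w r ^+ 2.

Let cA : continuous A.
Proof. by move=> r; exact: (is_derive_continuous (dA r)). Qed.

Let cA1 : continuous A1.
Proof. by move=> r; exact: (is_derive_continuous (dA1 r)). Qed.

Let cdw : continuous (derive1 w).
Proof. by move=> r; have [_] := hw (I : setT r). Qed.

Let cG : continuous G.
Proof.
move=> r; apply: cvgM.
  apply: cvgB; first exact: cA2.
  apply: cvgM; first exact: cA1.
  apply: cvgM; first exact: cdw.
  by apply: cvgV; [rewrite gt_eqF|exact: continuous_warp_weight].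
apply: cvgV; first by rewrite gt_eqF// exprn_gt0.
by rewrite expr2; apply: cvgM; exact: continuous_warp_weight.
Qed.

Let GM r : `|G r| <= be / (w r * (1 + (r - X) ^+ 2)).
Proof.
have q0 := onepsqr_gt0 (r - X); have w20 : 0 < w r ^+ 2 by rewrite exprn_gt0.
rewrite /G normrM [X in _ * X]ger0_norm ?invr_ge0 ?(ltW w20)//.
rewrite ler_pdivrMr//.
rewrite [leRHS](_ : _ = be * w r / (1 + (r - X) ^+ 2)); last first.
  by field; rewrite !gt_eqF.
rewrite (le_trans _ (hG r))// (le_trans (ler_normB _ _))// lerD2l normrM mulrC.
by rewrite ler_wpM2r.
Qed.

Let cos_cont (k al' t : R) : {for t, continuous (fun t => cos (k * t + al'))}.
Proof.
apply: continuous_comp; last exact: continuous_cos.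
apply: cvgD; last exact: cvg_cst.
by apply: cvgM; [exact: cvg_cst|exact: cvg_id].
Qed.

Let J (k ph : R) := \int[mu]_(t in D) (A (F t) * cos (k * t + ph)).

Let comp_cont (H : R -> R) t : continuous H -> D t -> {for t, continuous (H \o F)}.
Proof.
by move=> cH Dt; apply: continuous_comp; [exact: (warp_cvg hF)|exact: cH].
Qed.

Let dom (H : R -> R) (c : R) k ph : continuous H -> 0 <= c ->
  (forall r, `|H r| <= c / (w r * (1 + (r - X) ^+ 2))) ->
  mu.-integrable D (EFin \o (fun t => H (F t) * cos (k * t + ph))) /\
  `|\int[mu]_(t in D) (H (F t) * cos (k * t + ph))| <= c * pi.
Proof.
move=> cH c0 Hc.
have [||h1 h2] := @warp_dominated _ _ _ hD hF (fun t => H (F t) * cos (k * t + ph)) c X.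
- move=> t Dt; apply: cvgM; last exact: cos_cont.
  exact: (comp_cont cH Dt).
- move=> t Dt; rewrite (warp_majE hD hF)// normrM.
  by rewrite -[leRHS]mulr1 ler_pM// normr_cos_le1.
by split => //; exact: h2.
Qed.

Lemma osc_le_size k ph : `|J k ph| <= al * pi.
Proof. by have [] := dom k ph cA al0 hA. Qed.

Lemma integrable_osc_size k ph :
  mu.-integrable D (EFin \o (fun t => A (F t) * cos (k * t + ph))).
Proof. by have [] := dom k ph cA al0 hA. Qed.

Let q_cvg (u : nat -> R) : (u n ^+ 2 @[n --> \oo] --> +oo) ->
  (ga / (1 + u n ^+ 2)) @[n --> \oo] --> (0:R).
Proof.
move=> uy; rewrite -(mulr0 ga); apply: cvgM; first exact: cvg_cst.
apply/gtr0_cvgV0; first by apply: nearW => n; exact: onepsqr_gt0.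
apply: ger_cvgy uy; apply: nearW => n; by rewrite lerDr.
Qed.

Let sqr_cvg (s : R) : s ^+ 2 = 1 -> ((s * n.+1%:R - X) ^+ 2) @[n --> \oo] --> +oo.
Proof.
move=> s1; apply/cvgryPge => M; near=> n.
pose a := s * X.
have -> : (s * n.+1%:R - X) ^+ 2 = (n.+1%:R - a) ^+ 2.
  rewrite /a (_ : (n.+1%:R - s * X) ^+ 2 = (s ^+ 2) * (n.+1%:R - X * s) ^+ 2).
    rewrite -exprMn; congr (_ ^+ 2); rewrite mulrBr mulrCA -expr2 s1 mulr1//.
  by rewrite s1 mul1r mulrC.
have h1 : 1 <= n.+1%:R - a.
  rewrite lerBrDr (@le_trans _ _ n%:R) ?ler_nat//.
  by near: n; exact: nbhs_infty_ger.
rewrite (@le_trans _ _ (n.+1%:R - a))//.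
  rewrite lerBrDr (@le_trans _ _ n%:R) ?ler_nat//.
  by near: n; exact: nbhs_infty_ger.
by rewrite expr2 ler_peMl// (le_trans ler01).
Unshelve. all: by end_near.
Qed.

(** Since F' * w o F = 1, the function e below satisfies e' = e0 + k^-2 * e2,
    where e0 is the integrand and e2 has G in place of A; this is the outcome of
    two integrations by parts.  As e vanishes at both ends of D, the integral of
    e0 is - k^-2 times that of e2. *)
Lemma osc_le_freq k ph : k != 0 -> k ^+ 2 * `|J k ph| <= be * pi.
Proof.
move=> k0.
pose e t := A (F t) * (sin (k * t + ph) / k) + (A1 (F t) / w (F t)) * (cos (k * t + ph) / k ^+ 2).
pose e' t := A (F t) * cos (k * t + ph) + k ^- 2 * (G (F t) * cos (k * t + ph)).
have oD := warp_open hD.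
have de t : D t -> is_derive t 1 e (e' t).
  move=> Dt; have dF := warp_is_derive hF Dt.
  have lin : is_derive t 1 (fun t : R => k * t + ph) k.
    by apply: is_derive_eq; rewrite addr0 scaler1.
  have ds : is_derive t 1 (fun t : R => sin (k * t + ph)) (cos (k * t + ph) * k).
    exact: (@is_derive1_comp _ sin (fun t => k * t + ph)).
  have dc : is_derive t 1 (fun t : R => cos (k * t + ph)) (- sin (k * t + ph) * k).
    exact: (@is_derive1_comp _ cos (fun t => k * t + ph)).
  have dAF : is_derive t 1 (fun t : R => A (F t)) (A1 (F t) * derive1 F t).
    exact: (@is_derive1_comp _ A F).
  have dA1F : is_derive t 1 (fun t : R => A1 (F t)) (A2 (F t) * derive1 F t).
    exact: (@is_derive1_comp _ A1 F).
  have dwF : is_derive t 1 (fun t : R => w (F t)) (derive1 w (F t) * derive1 F t).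
    apply: (@is_derive1_comp _ w F); exact: warp_weight_is_derive.
  have dwV : is_derive t 1 (fun t : R => (w (F t))^-1)
      (- (w (F t)) ^- 2 * (derive1 w (F t) * derive1 F t)).
    by apply: is_deriveV; rewrite gt_eqF.
  rewrite /e /e'; apply: is_derive_eq; rewrite /GRing.scale /= /G.
  rewrite (warp_weight_derive1 hD hF Dt).
  have := w0 (F t) => /gt_eqF wn.
  by field; rewrite wn k0.
have iA := integrable_osc_size k ph.
have [iG bG] := dom k ph cG be0 GM.
have mD := measurable_warp hD.
have iG' : mu.-integrable D (EFin \o (fun t => k ^- 2 * (G (F t) * cos (k * t + ph)))).
  exact: (integrableZl mD (k ^- 2) iG).
have ie' : mu.-integrable D (EFin \o e').
  exact: (integrableD mD iA iG').
have ce' t : D t -> {for t, continuous e'}.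
  move=> Dt; apply: cvgD.
    by apply: cvgM; [exact: (comp_cont cA Dt)|exact: cos_cont].
  apply: cvgM; first exact: cvg_cst.
  by apply: cvgM; [exact: (comp_cont cG Dt)|exact: cos_cont].
have e0 (s : R) : s ^+ 2 = 1 -> e (phi (s * n.+1%:R)) @[n --> \oo] --> (0:R).
  move=> s1; have qc := q_cvg (sqr_cvg s1).
  pose C := `|k|^-1 + k ^- 2.
  have bd n : `|e (phi (s * n.+1%:R))| <=
      ga / (1 + (s * n.+1%:R - X) ^+ 2) * C.
    rewrite /e (warp_invK hF) /C mulrDr (le_trans (ler_normD _ _))// lerD//.
      rewrite !normrM normfV; apply: ler_pM => //.
      rewrite -[leRHS]mul1r ler_wpM2r ?invr_ge0// ler_norml.
      by rewrite sin_geN1 sin_le1.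
    rewrite !normrM [`|(w _)^-1|]ger0_norm ?invr_ge0 ?(ltW (w0 _))//.
    apply: ler_pM; rewrite ?mulr_ge0 ?invr_ge0 ?(ltW (w0 _))//.
    rewrite [X in _ * X]ger0_norm ?invr_ge0 ?sqr_ge0//.
    by rewrite -[leRHS]mul1r ler_wpM2r ?invr_ge0 ?sqr_ge0// normr_cos_le1.
  have qc' : ga / (1 + (s * n.+1%:R - X) ^+ 2) * C @[n --> \oo] --> (0:R).
    by rewrite -(mul0r C); apply: cvgM => //; exact: cvg_cst.
  apply/norm_cvg0P; apply: (squeeze_cvgr _ (@cvg_cst _ (0:R) _ _ _) qc').
  by apply: nearW => n; rewrite normr_ge0 bd.
have := FTC_exhaustion oD (warp_exhausts hD hF) de ce' (l := 0) (L := 0) ie'.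
have p1 : e \o (fun n => phi (- n.+1%:R)) @ \oo --> (0 : R).
  have := e0 (-1); rewrite sqrrN expr1n => /(_ erefl).
  by under eq_fun do rewrite mulN1r.
have p2 : e \o (fun n => phi n.+1%:R) @ \oo --> (0 : R).
  have := e0 1; rewrite expr1n => /(_ erefl).
  by under eq_fun do rewrite mul1r.
move=> /(_ p1 p2); rewrite subr0 => I0.
have : \int[mu]_(t in D) e' t = 0 by rewrite /Rintegral I0.
rewrite RintegralD// RintegralZl// -/(J k ph) => /eqP; rewrite addr_eq0 => /eqP ->.
by rewrite normrN normrM [`|k ^- 2|]ger0_norm ?invr_ge0 ?sqr_ge0// mulVKf// expf_neq0.
Qed.

End Oscillatory.

(** * Control weights and decay of the amplitude *)

(** One function bounds all the ratios that occur, w X / w Y and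
    m1 (F^-1 X) / m1 (F^-1 Y), in terms of X - Y.  The quadratic lower bound makes
    its inverse integrable, so that powers of rho are the only currency in the
    estimates. *)
Definition control_weight (R : realType) (rho : R -> R) :=
  [/\ forall z, 1 + z ^+ 2 <= rho z, forall z, rho (- z) = rho z &
      forall x y, rho (x + y) <= rho x * rho y].

Section KernelBound.
Context {R : realType} (D : set R) (F : R -> R).
Hypothesis hD : D = setT \/ D = [set x : R | 0 < x].
Hypothesis hF : warping D F.
Local Notation mu := (@lebesgue_measure R).
Local Notation phi := (warp_inv D F).
Local Notation w := (warp_weight D F).
Hypothesis hw : C1_on setT w.
Variable (D1 : R).
Hypothesis hD1 : forall x : R, `|derive1 w x / w x| <= D1.
Variable (rho : R -> R).

Hypothesis rho_ctl : control_weight rho.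
Hypothesis w_rho : forall X Y, w X <= rho (X - Y) * w Y.

(** The exponent 8 is spent as follows: six powers become decay in X - Y and two
    give integrability in r (see [rapid_controlledM]). *)
Definition rapid (c : R) (a : R -> R) := exists a1 a2, [/\
  forall r : R, is_derive r 1 a (a1 r), forall r : R, is_derive r 1 a1 (a2 r),
  continuous a2 & forall r, [/\ `|a r| <= c / rho r ^+ 8,
                    `|a1 r| <= c / rho r ^+ 8 & `|a2 r| <= c / rho r ^+ 8]].

Let w0 x : 0 < w x. Proof. exact: (warp_weight_gt0 hF). Qed.

Let D10 : 0 <= D1. Proof. exact: le_trans (hD1 0). Qed.

Lemma rho_ge1 z : 1 <= rho z.
Proof. by case: rho_ctl => h _ _; rewrite (le_trans _ (h z))// lerDl sqr_ge0. Qed.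

Lemma rho_gt0 z : 0 < rho z.
Proof. exact: lt_le_trans (rho_ge1 z). Qed.

Lemma rho_sub x y : rho (x - y) = rho (y - x).
Proof. by case: rho_ctl => _ h _; rewrite -h opprB. Qed.

(** The size bound is of order w X and the frequency bound of order
    1 / (w X * s^2); their combination is the Lorentz profile of width 1 / w X. *)
Lemma osc_lorentz (A A1 A2 : R -> R) (X ka s ph : R) : 0 <= ka ->
  (forall r : R, is_derive r 1 A (A1 r)) -> (forall r : R, is_derive r 1 A1 (A2 r)) ->
  continuous A2 ->
  (forall r, [/\ `|A r| <= ka / rho (r - X) ^+ 2,
             `|A1 r| <= ka / rho (r - X) ^+ 2 & `|A2 r| <= ka / rho (r - X) ^+ 2]) ->
  mu.-integrable D (EFin \o (fun t => A (F t) * cos (2 * pi * s * t + ph))) /\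
  `|\int[mu]_(t in D) (A (F t) * cos (2 * pi * s * t + ph))| <=
    ka * (pi * (2 + D1)) * lorentz (w X) 0 s.
Proof.
move=> ka0 dA dA1 cA2 AM.
have rg z : 1 + z ^+ 2 <= rho z by case: rho_ctl.
have q0 r : 0 < 1 + (r - X) ^+ 2 by exact: onepsqr_gt0.
have p0 : 0 < pi :> R by exact: pi_gt0.
have wr r : w r <= rho (r - X) * w X by exact: w_rho.
have wX r : w X <= rho (r - X) * w r by rewrite rho_sub; exact: w_rho.
have H1 r : ka / rho (r - X) ^+ 2 <= ka * w X / (w r * (1 + (r - X) ^+ 2)).
  rewrite -mulrA ler_wpM2l// ler_pdivlMr ?mulr_gt0// mulrC ler_pdivrMr ?exprn_gt0 ?rho_gt0//.
  have -> : w X * rho (r - X) ^+ 2 = (rho (r - X) * w X) * rho (r - X) by ring.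
  by apply: ler_pM => //; rewrite ltW.
have H2 r : ka / rho (r - X) ^+ 2 <= ka / w X * w r / (1 + (r - X) ^+ 2).
  rewrite -!mulrA ler_wpM2l// mulrA ler_pdivlMr// mulrC ler_pdivrMr ?exprn_gt0 ?rho_gt0//.
  rewrite mulrAC -mulrA mulrC; rewrite ler_pdivlMr//.
  have -> : rho (r - X) ^+ 2 * w r = rho (r - X) * (rho (r - X) * w r) by ring.
  by apply: ler_pM => //; rewrite ltW.
have H0 r : ka / rho (r - X) ^+ 2 <= ka / (1 + (r - X) ^+ 2).
  rewrite ler_wpM2l// lef_pV2 ?posrE ?exprn_gt0 ?rho_gt0//.
  by rewrite (le_trans (rg _))// expr2 ler_peMr ?rho_ge1// ltW// rho_gt0.
have al0 : 0 <= ka * w X by rewrite mulr_ge0// ltW.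
have be0 : 0 <= (1 + D1) * (ka / w X) by rewrite mulr_ge0 ?addr_ge0// divr_ge0// ltW.
pose ga := ka + ka / w X.
have ga0 : 0 <= ga by rewrite addr_ge0// divr_ge0// ltW.
have hA r : `|A r| <= ka * w X / (w r * (1 + (r - X) ^+ 2)).
  by case: (AM r) => h _ _; rewrite (le_trans h).
have hG r : `|A2 r| + D1 * `|A1 r| <= (1 + D1) * (ka / w X) * w r / (1 + (r - X) ^+ 2).
  case: (AM r) => _ h1 h2.
  rewrite -!mulrA mulrDl mul1r !mulrA lerD//; first by rewrite (le_trans h2).
  by rewrite -!mulrA ler_wpM2l// !mulrA (le_trans h1).
have hA0 r : `|A r| <= ga / (1 + (r - X) ^+ 2).
  case: (AM r) => h _ _; rewrite (le_trans h)// (le_trans (H0 r))//.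
  by rewrite ler_wpM2r ?invr_ge0 ?(ltW (q0 r))// lerDl divr_ge0// ltW.
have hA1 r : `|A1 r| / w r <= ga / (1 + (r - X) ^+ 2).
  case: (AM r) => _ h _; rewrite ler_pdivrMr//.
  rewrite (le_trans h)// (le_trans (H2 r))// mulrAC ler_wpM2r ?(ltW (w0 r))//.
  by rewrite ler_wpM2r ?invr_ge0 ?(ltW (q0 r))// lerDr.
split.
  exact: (@integrable_osc_size _ _ _ hD hF A A1 X (ka * w X)).
have b1 := @osc_le_size _ _ _ hD hF A A1 X (ka * w X) dA al0 hA (2 * pi * s) ph.
have b2 : 2 * pi * s != 0 -> _ := @osc_le_freq _ _ _ hD hF hw D1 hD1 A A1 A2 X _ _ ga dA dA1 cA2 al0 be0
  hA hG hA0 hA1 (2 * pi * s) ph.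
set J := \int[mu]_(t in D) _ in b1 b2 *.
have J0 : 0 <= `|J| by [].
move: `|J| b1 b2 J0 => j b1 b2 J0.
rewrite /lorentz subr0 mulrA ler_pdivlMr ?onepsqr_gt0// mulrDr mulr1.
rewrite [leRHS](_ : _ = ka * w X * pi + (1 + D1) * ka * w X * pi); last by ring.
apply: lerD => //.
have [->|s0] := eqVneq s 0.
  rewrite mulr0 expr2 !mulr0; apply: mulr_ge0; last exact: ltW.
  by apply: mulr_ge0; [apply: mulr_ge0 => //; exact: addr_ge0|exact: ltW].
have k0 : 2 * pi * s != 0 by rewrite !mulf_neq0// gt_eqF.
have {}b2 := b2 k0.
have pi1 : 1 <= pi :> R by have := pi_ge2 R; lra.
have wX0 := w0 X.
have w2 : 0 <= (w X) ^+ 2 by rewrite sqr_ge0.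
have h : s ^+ 2 * j <= (2 * pi * s) ^+ 2 * j.
  rewrite ler_wpM2r// !exprMn ler_peMl ?sqr_ge0//.
  have : 1 <= (2 * pi : R) ^+ 2 by rewrite expr_ge1//; lra.
  by rewrite exprMn.
have := ler_wpM2l w2 (le_trans h b2).
rewrite [X in X <= _](_ : _ = j * (w X * s) ^+ 2); last by ring.
rewrite [X in _ <= X](_ : _ = (1 + D1) * ka * w X * pi)//.
by move: pi => q; field; rewrite gt_eqF.
Qed.

(** The condition on an amplitude A under which both bounds on its oscillatory
    integral are available, with constants proportional to ka: one power of rho
    compares w r with w X and the other gives the factor 1 / (1 + (r - X)^2). *)
Definition controlled (X ka : R) (A : R -> R) := exists A1 A2, [/\
  forall r : R, is_derive r 1 A (A1 r), forall r : R, is_derive r 1 A1 (A2 r),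
  continuous A2 & forall r, [/\ `|A r| <= ka / rho (r - X) ^+ 2,
             `|A1 r| <= ka / rho (r - X) ^+ 2 & `|A2 r| <= ka / rho (r - X) ^+ 2]].

Lemma controlledD X ka kb A B : controlled X ka A -> controlled X kb B ->
  controlled X (ka + kb) (fun r => A r + B r).
Proof.
move=> [A1 [A2 [dA dA1 cA2 AM]]] [B1 [B2 [dB dB1 cB2 BM]]].
exists (fun r => A1 r + B1 r), (fun r => A2 r + B2 r); split.
- by move=> r; exact: is_deriveD.
- by move=> r; exact: is_deriveD.
- by move=> r; apply: cvgD; [exact: cA2|exact: cB2].
- move=> r; case: (AM r) => a0 a1 a2; case: (BM r) => b0 b1 b2.
  by split; rewrite mulrDl (le_trans (ler_normD _ _))// lerD.
Qed.

Lemma controlledN X ka A : controlled X ka A -> controlled X ka (fun r => - A r).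
Proof.
move=> [A1 [A2 [dA dA1 cA2 AM]]].
exists (fun r => - A1 r), (fun r => - A2 r); split.
- by move=> r; exact: is_deriveN.
- by move=> r; exact: is_deriveN.
- by move=> r; apply: cvgN; exact: cA2.
- by move=> r; case: (AM r) => a0 a1 a2; rewrite !normrN.
Qed.

Let is_derive_sub (a a1 : R -> R) (Y r : R) : (forall r : R, is_derive r 1 a (a1 r)) ->
  is_derive r 1 (fun r : R => a (r - Y)) (a1 (r - Y)).
Proof.
move=> da; rewrite -[X in is_derive _ _ _ X]mulr1.
apply: (@is_derive1_comp _ a (fun r => r - Y)).
by apply: is_derive_eq; rewrite subr0.
Qed.

Lemma rapid_controlled c a X : rapid c a -> controlled X c (fun r => a (r - X)).
Proof.
move=> [a1 [a2 [da da1 ca2 aM]]].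
have le_ r : c / rho (r - X) ^+ 8 <= c / rho (r - X) ^+ 2.
  have c0 : 0 <= c.
    case: (aM 0) => h _ _; have := le_trans (normr_ge0 _) h.
    by rewrite pmulr_lge0// invr_gt0 exprn_gt0// rho_gt0.
  rewrite ler_wpM2l// lef_pV2 ?posrE ?exprn_gt0 ?rho_gt0//.
  by rewrite ler_weXn2l// rho_ge1.
exists (fun r => a1 (r - X)), (fun r => a2 (r - X)); split.
- by move=> r; exact: is_derive_sub.
- by move=> r; exact: is_derive_sub.
- move=> r; apply: continuous_comp; last exact: ca2.
  by apply: cvgB; [exact: cvg_id|exact: cvg_cst].
- by move=> r; case: (aM (r - X)) => h h1 h2; split; rewrite (le_trans _ (le_ r)).
Qed.

(** Submultiplicativity gives rho (X - Y) <= rho (r - Y) * rho (r - X), so six of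
    the eight powers of each factor can be traded for rho (X - Y)^-6. *)
Lemma rapid_controlledM c a b X Y : 0 <= c -> rapid c a -> rapid c b ->
  controlled X (4 * c ^+ 2 / rho (X - Y) ^+ 6) (fun r => a (r - Y) * b (r - X)).
Proof.
move=> c0 [a1 [a2 [da da1 ca2 aM]]] [b1 [b2 [db db1 cb2 bM]]].
have le_ r : c / rho (r - Y) ^+ 8 * (c / rho (r - X) ^+ 8) <=
    c ^+ 2 / rho (X - Y) ^+ 6 / rho (r - X) ^+ 2.
  have P1 := rho_ge1 (r - Y); have Q1 := rho_ge1 (r - X).
  have Z1 := rho_ge1 (X - Y).
  have ZPQ : rho (X - Y) <= rho (r - Y) * rho (r - X).
    case: rho_ctl => _ _ h.
    by rewrite [rho (r - X)]rho_sub (le_trans _ (h _ _))// [_ + (X - r)](_ : _ = X - Y)//; ring.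
  rewrite mulrACA -expr2 -invfM -mulrA -invfM ler_wpM2l ?sqr_ge0//.
  move: (rho (r - Y)) (rho (r - X)) (rho (X - Y)) P1 Q1 Z1 ZPQ => P Q Z P1 Q1 Z1 ZPQ.
  have P0 : 0 < P by exact: lt_le_trans P1.
  have Q0 : 0 < Q by exact: lt_le_trans Q1.
  have Z0 : 0 < Z by exact: lt_le_trans Z1.
  rewrite lef_pV2 ?posrE ?mulr_gt0 ?exprn_gt0//.
  have -> : P ^+ 8 * Q ^+ 8 = (P * Q) ^+ 6 * (P ^+ 2 * Q ^+ 2) by ring.
  apply: ler_pM; rewrite ?exprn_ge0 ?(ltW Q0) ?(ltW Z0)//.
    by rewrite lerXn2r// nnegrE ?mulr_ge0 ?(ltW P0) ?(ltW Q0) ?(ltW Z0).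
  by rewrite ler_peMl ?exprn_ge0 ?(ltW Q0)// expr_ge1// ltW.
have [dA dB] := (is_derive_sub Y ^~ da, is_derive_sub X ^~ db).
have [dA1 dB1] := (is_derive_sub Y ^~ da1, is_derive_sub X ^~ db1).
exists (fun r => a1 (r - Y) * b (r - X) + a (r - Y) * b1 (r - X)).
exists (fun r => a2 (r - Y) * b (r - X) + a1 (r - Y) * b1 (r - X) +
  (a1 (r - Y) * b1 (r - X) + a (r - Y) * b2 (r - X))).
have cb' Y' (u u1 : R -> R) : (forall r : R, is_derive r 1 u (u1 r)) ->
    continuous (fun r => u (r - Y')).
  by move=> du r; apply: (@is_derive_continuous _ _ _ (u1 (r - Y'))); exact: is_derive_sub.
have cc (u : R -> R) Y' : continuous u -> continuous (fun r => u (r - Y')).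
  move=> cu r; apply: continuous_comp; last exact: cu.
  by apply: cvgB; [exact: cvg_id|exact: cvg_cst].
split.
- move=> r; have := dA r; have := dB r => ? ?.
  by apply: is_derive_eq; rewrite /GRing.scale /= addrC mulrC [X in _ + X]mulrC; ring.
- move=> r; have := dA r; have := dB r; have := dA1 r; have := dB1 r => ? ? ? ?.
  by apply: is_derive_eq; rewrite /GRing.scale /=; ring.
- move=> r; apply: cvgD; apply: cvgD; apply: cvgM;
    first [exact: (cb' _ a a1)|exact: (cb' _ b b1)|exact: (cb' _ a1 a2)
    |exact: (cb' _ b1 b2)|exact: cc].
- move=> r; case: (aM (r - Y)) => a0' a1' a2'; case: (bM (r - X)) => b0' b1' b2'.
  have m u v : `|u| <= c / rho (r - Y) ^+ 8 -> `|v| <= c / rho (r - X) ^+ 8 ->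
      `|u * v| <= c ^+ 2 / rho (X - Y) ^+ 6 / rho (r - X) ^+ 2.
    by move=> hu hv; rewrite normrM (le_trans _ (le_ r))// ler_pM.
  have mab := m _ _ a0' b0'; have ma1b := m _ _ a1' b0'; have mab1 := m _ _ a0' b1'.
  have ma2b := m _ _ a2' b0'; have mab2 := m _ _ a0' b2'; have ma1b1 := m _ _ a1' b1'.
  set T := c ^+ 2 / rho (X - Y) ^+ 6 / rho (r - X) ^+ 2 in mab ma1b mab1 ma2b mab2 ma1b1.
  have -> : 4 * c ^+ 2 / rho (X - Y) ^+ 6 / rho (r - X) ^+ 2 = 4 * T by rewrite /T; ring.
  have T0 : 0 <= T by exact: le_trans mab.
  split.
  + by lra.
  + rewrite (le_trans (ler_normD _ _))//; lra.
  + rewrite (le_trans (ler_normD _ _))// (le_trans (lerD (ler_normD _ _) (ler_normD _ _)))//; lra.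
Qed.

End KernelBound.

(** * The pointwise estimate of the kernel *)

Section KernelEstimate.
Local Open Scope complex_scope.
Local Open Scope ring_scope.
Context {R : realType} (D : set R) (F : R -> R).
Hypothesis hD : D = setT \/ D = [set x : R | 0 < x].
Hypothesis hF : warping D F.
Local Notation mu := (@lebesgue_measure R).
Local Notation phi := (warp_inv D F).
Local Notation w := (warp_weight D F).
Hypothesis hw : C1_on setT w.
Variable (D1 : R).
Hypothesis hD1 : forall x : R, `|derive1 w x / w x| <= D1.
Variable (rho : R -> R).
Hypothesis rho_ctl : control_weight rho.
Hypothesis w_rho : forall X Y, w X <= rho (X - Y) * w Y.

Let w0 x : 0 < w x. Proof. exact: (warp_weight_gt0 hF). Qed.
Let D10 : 0 <= D1. Proof. exact: le_trans (hD1 0). Qed.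

Definition real_zero_ext (h : R -> R) (t : R) : R := if t \in D then h t else 0.

Lemma Rintegral_zero_ext h : \int[mu]_t real_zero_ext h t = \int[mu]_(t in D) h t.
Proof.
rewrite [RHS]Rintegral_mkcond; apply: eq_Rintegral => t _.
by rewrite /real_zero_ext patchE.
Qed.

Lemma integrable_zero_ext h : mu.-integrable D (EFin \o h) -> mu.-integrable setT (EFin \o real_zero_ext h).
Proof.
move=> /(integrable_mkcond _ (measurable_warp hD)).
rewrite (_ : (EFin \o h) \_ D = EFin \o real_zero_ext h)//.
by apply/funext => t; rewrite /real_zero_ext patchE /=; case: ifP.
Qed.

Lemma continuous_zero_ext h t : D t -> {for t, continuous h} -> {for t, continuous (real_zero_ext h)}.
Proof.
move=> Dt ch; have oD := warp_open hD.
have nD : \forall x \near t, D x by exact: open_nbhs_nbhs.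
rewrite /prop_for /continuous_at {2}/real_zero_ext mem_set//.
apply: cvg_trans ch; apply: near_eq_cvg.
by near=> x; rewrite /real_zero_ext mem_set//; near: x.
Unshelve. all: by end_near.
Qed.

Lemma lorentz_le (c s : R) : 0 < c -> lorentz c 0 s <= (c + c^-1) * lorentz 1 0 s.
Proof.
move=> c0; rewrite /lorentz subr0 !mul1r ler_pdivrMr ?onepsqr_gt0//.
rewrite mulrAC ler_pdivlMr ?onepsqr_gt0//.
have -> : (c + c^-1) * (1 + (c * s) ^+ 2) = c + c * s ^+ 2 + c^-1 + c * (c * s) ^+ 2.
  by field; rewrite gt_eqF.
have h1 : 0 <= c^-1 by rewrite invr_ge0 ltW.
have h2 : 0 <= c * (c * s) ^+ 2 by rewrite mulr_ge0 ?sqr_ge0// ltW.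
by lra.
Qed.

(** The Lorentz profiles of widths 1 / c and 1 differ by a bounded factor, so the
    bound on oscillatory integrals is the decay required for inversion. *)
Lemma controlled_nice (X ka q : R) (A : R -> R) : 0 <= ka -> controlled rho X ka A ->
  fourier_nice (real_zero_ext (fun t => q * A (F t))).
Proof.
move=> ka0 [A1 [A2 [dA dA1 cA2 AM]]].
have oscl s ph := osc_lorentz hD hF hw hD1 rho_ctl w_rho s ph ka0 dA dA1 cA2 AM.
have mD := measurable_warp hD.
split.
- apply: integrable_zero_ext; have [i _] := oscl 0 0.
  rewrite (_ : EFin \o _ = EFin \o (fun t => q * (A (F t) * cos (2 * pi * 0 * t + 0)))).
    exact: (integrableZl mD q i).
  by apply/funext => t /=; rewrite mulr0 mul0r addr0 cos0 mulr1.
- exists (`|q| * ka) => t; rewrite /real_zero_ext; case: ifP => _; last by rewrite normr0 mulr_ge0.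
  rewrite normrM ler_wpM2l//; case: (AM (F t)) => h _ _; rewrite (le_trans h)//.
  rewrite ler_pdivrMr ?exprn_gt0 ?(rho_gt0 rho_ctl)// ler_peMr//.
  by rewrite expr_ge1 ?(ltW (rho_gt0 rho_ctl _))// (rho_ge1 rho_ctl).
- exists (`|q| * (ka * (pi * (2 + D1)) * (w X + (w X)^-1))) => s al.
  rewrite /osc_integral.
  have -> : \int[mu]_t (real_zero_ext (fun t => q * A (F t)) t * cos (2 * pi * t * s + al)) =
      q * \int[mu]_(t in D) (A (F t) * cos (2 * pi * s * t + al)).
    have [i _] := oscl s al.
    rewrite -RintegralZl// -Rintegral_zero_ext; apply: eq_Rintegral => t _.
    rewrite /real_zero_ext; case: ifP => _; last by rewrite mul0r.
    by rewrite mulrA; congr (_ * cos (_ + _)); move: pi => p; ring.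
  have [_ b] := oscl s al.
  rewrite normrM -[leRHS]mulrA; apply: ler_wpM2l => //.
  rewrite (le_trans b)// -[leRHS]mulrA; apply: ler_wpM2l.
    by apply: mulr_ge0 => //; apply: mulr_ge0; [exact: pi_ge0|exact: addr_ge0].
  exact: lorentz_le.
Qed.

Section theta.
Variables (theta : R -> R[i]) (c : R).
Hypothesis c0 : 0 <= c.
Hypothesis th_re : rapid rho c (fun r => complex.Re (theta r)).
Hypothesis th_im : rapid rho c (fun r => complex.Im (theta r)).

Let a r := complex.Re (theta r).
Let b r := complex.Im (theta r).
Let sq x := Num.sqrt (derive1 F x).

Lemma Re_warped x t :
  complex.Re (warped D F theta x t) = real_zero_ext (fun t => sq x * a (F t - F x)) t.
Proof.
by rewrite /warped /zero_ext /real_zero_ext; case: ifP => //= _; rewrite ReM /= mul0r subr0.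
Qed.

Lemma Im_warped x t :
  complex.Im (warped D F theta x t) = real_zero_ext (fun t => sq x * b (F t - F x)) t.
Proof.
by rewrite /warped /zero_ext /real_zero_ext; case: ifP => //= _; rewrite ImM /= mul0r addr0.
Qed.

Lemma warped_nice x : cfourier_nice (warped D F theta x).
Proof.
split.
  under eq_fun do rewrite Re_warped.
  exact: (controlled_nice (sq x) c0 (rapid_controlled rho_ctl (F x) th_re)).
under eq_fun do rewrite Im_warped.
exact: (controlled_nice (sq x) c0 (rapid_controlled rho_ctl (F x) th_im)).
Qed.

Let rapid_continuous u : rapid rho c u -> continuous u.
Proof. by move=> [u1 [_ [du _ _ _]]] r; exact: (is_derive_continuous (du r)). Qed.

Lemma warped_continuous x t : D t ->
  {for t, continuous (fun s => complex.Re (warped D F theta x s))} /\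
  {for t, continuous (fun s => complex.Im (warped D F theta x s))}.
Proof.
move=> Dt.
have H u : continuous u -> {for t, continuous (real_zero_ext (fun t => sq x * u (F t - F x)))}.
  move=> cu; apply: continuous_zero_ext => //; apply: cvgM; first exact: cvg_cst.
  apply: continuous_comp; last exact: cu.
  by apply: cvgB; [exact: (warp_cvg hF)|exact: cvg_cst].
split.
  rewrite (_ : (fun s => _) = real_zero_ext (fun t => sq x * a (F t - F x))).
    by apply: H; exact: rapid_continuous.
  by apply/funext => s; exact: Re_warped.
rewrite (_ : (fun s => _) = real_zero_ext (fun t => sq x * b (F t - F x))).
  by apply: H; exact: rapid_continuous.
by apply/funext => s; exact: Im_warped.
Qed.

(** The inner product of two atoms is the Fourier integral of the product of the
    warped windows, which are continuous on D and vanish outside it. *)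
Lemma kernel_fourier x y xi om :
  inner (atom D F theta y om) (atom D F theta x xi) =
  cintegral (fun t => warped D F theta y t * (warped D F theta x t)^* *
    expi (2 * pi * t * (xi - om))).
Proof.
apply: parseval; first exact: warped_nice.
  by apply: cfourier_nice_integrable; exact: warped_nice.
move=> t; have [tD|tD] := boolP (t \in D).
  by right; apply: warped_continuous; rewrite inE in tD.
by left; rewrite /warped /zero_ext (negbTE tD).
Qed.

(** The real and imaginary parts of theta (r - Y) * conj (theta (r - X)) are
    controlled with constant 8 c^2 rho (X - Y)^-6, and the normalization
    (w X * w Y)^(-1/2) is at most rho (X - Y) / w X. *)
Lemma kernel_le x y xi om : D x -> D y ->
  Normc.normc (inner (atom D F theta y om) (atom D F theta x xi)) <=
  32 * c ^+ 2 * (pi * (2 + D1)) / rho (F x - F y) ^+ 5 /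
    (1 + (w (F x) * (xi - om)) ^+ 2).
Proof.
move=> Dx Dy; rewrite kernel_fourier.
set X := F x; set Y := F y; set Z := rho (X - Y); set eta := xi - om.
pose q := sq x * sq y.
pose k4 := 4 * c ^+ 2 / Z ^+ 6.
have Z1 : 1 <= Z by exact: (rho_ge1 rho_ctl).
have Z0 : 0 < Z by exact: lt_le_trans Z1.
have k40 : 0 <= k4 by rewrite divr_ge0 ?mulr_ge0 ?sqr_ge0 ?exprn_ge0 ?(ltW Z0).
pose Are r := a (r - Y) * a (r - X) + b (r - Y) * b (r - X).
pose Aim r := b (r - Y) * a (r - X) + - (a (r - Y) * b (r - X)).
have pM u v : rapid rho c u -> rapid rho c v ->
    controlled rho X k4 (fun r => u (r - Y) * v (r - X)).
  by move=> ru rv; exact: rapid_controlledM.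
have cre : controlled rho X (k4 + k4) Are by apply: controlledD; exact: pM.
have cim : controlled rho X (k4 + k4) Aim.
  by apply: controlledD; [|apply: controlledN]; exact: pM.
have k80 : 0 <= k4 + k4 by rewrite addr_ge0.
pose B := (k4 + k4) * (pi * (2 + D1)) * lorentz (w X) 0 eta.
have osc_ A ph : controlled rho X (k4 + k4) A ->
    mu.-integrable D (EFin \o (fun t => A (F t) * cos (2 * pi * eta * t + ph))) /\
    `|\int[mu]_(t in D) (A (F t) * cos (2 * pi * eta * t + ph))| <= B.
  move=> [A1 [A2 [dA dA1 cA2 AM]]].
  exact: (osc_lorentz hD hF hw hD1 rho_ctl w_rho eta ph k80 dA dA1 cA2 AM).
have mD := measurable_warp hD.
pose C0 A t := A (F t) * cos (2 * pi * eta * t + 0).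
pose S0 A t := A (F t) * cos (2 * pi * eta * t - pi / 2).
have ReE : \int[mu]_t complex.Re (warped D F theta y t * (warped D F theta x t)^* *
    expi (2 * pi * t * eta)) =
    q * (\int[mu]_(t in D) C0 Are t - \int[mu]_(t in D) S0 Aim t).
  have [i1 _] := osc_ _ 0 cre; have [i2 _] := osc_ _ (- (pi / 2)) cim.
  rewrite -RintegralB// -RintegralZl//; last exact: (integrableB mD i1 i2).
  rewrite -Rintegral_zero_ext; apply: eq_Rintegral => t _.
  rewrite ReM ReM ImM Re_conj Im_conj !Re_warped !Im_warped /real_zero_ext /C0 /S0 /Are /Aim /q.
  case: ifP => _; last by rewrite !(mul0r, subr0, addr0).
  rewrite cosBpihalf addr0 /= -/X -/Y.
  have -> : 2 * pi * eta * t = 2 * pi * t * eta by rewrite mulrAC.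
  by ring.
have ImE : \int[mu]_t complex.Im (warped D F theta y t * (warped D F theta x t)^* *
    expi (2 * pi * t * eta)) =
    q * (\int[mu]_(t in D) S0 Are t + \int[mu]_(t in D) C0 Aim t).
  have [i1 _] := osc_ _ (- (pi / 2)) cre; have [i2 _] := osc_ _ 0 cim.
  rewrite -RintegralD// -RintegralZl//; last exact: (integrableD mD i1 i2).
  rewrite -Rintegral_zero_ext; apply: eq_Rintegral => t _.
  rewrite ImM ReM ImM Re_conj Im_conj !Re_warped !Im_warped /real_zero_ext /C0 /S0 /Are /Aim /q.
  case: ifP => _; last by rewrite !(mul0r, subr0, addr0).
  rewrite cosBpihalf addr0 /= -/X -/Y.
  have -> : 2 * pi * eta * t = 2 * pi * t * eta by rewrite mulrAC.
  by ring.
have q0 : 0 <= q by rewrite mulr_ge0 ?sqrtr_ge0.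
have B0 : 0 <= B by have [_] := osc_ _ 0 cre; exact: le_trans.
rewrite (le_trans (normc_le_norm1 _))// /norm1 /= ReE ImE.
have b1 : `|q * (\int[mu]_(t in D) C0 Are t - \int[mu]_(t in D) S0 Aim t)| <= q * (2 * B).
  rewrite normrM (ger0_norm q0) ler_wpM2l// (le_trans (ler_normB _ _))//.
  have [_ i1] := osc_ _ 0 cre; have [_ i2] := osc_ _ (- (pi / 2)) cim.
  by rewrite mulr_natl mulr2n lerD.
have b2 : `|q * (\int[mu]_(t in D) S0 Are t + \int[mu]_(t in D) C0 Aim t)| <= q * (2 * B).
  rewrite normrM (ger0_norm q0) ler_wpM2l// (le_trans (ler_normD _ _))//.
  have [_ i1] := osc_ _ (- (pi / 2)) cre; have [_ i2] := osc_ _ 0 cim.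
  by rewrite mulr_natl mulr2n lerD.
rewrite (le_trans (lerD b1 b2))//.
have wX0 := w0 X; have wY0 := w0 Y.
have qZ : q <= Z / w X.
  rewrite /q /sq (warp_weight_derive1 hD hF Dx) (warp_weight_derive1 hD hF Dy) -/X -/Y.
  have ZwX : 0 <= Z / w X by apply: divr_ge0; exact: ltW.
  rewrite -sqrtrM; last by rewrite invr_ge0 ltW.
  rewrite -(ger0_norm ZwX) -sqrtr_sqr; apply: ler_wsqrtr; rewrite expr2.
  apply: ler_pM; rewrite ?invr_ge0 ?(ltW wX0) ?(ltW wY0)//.
    by rewrite ler_peMl// invr_ge0 ltW.
  by rewrite ler_pdivlMr// mulrC ler_pdivrMr//; exact: w_rho.
have e1 : q * (2 * B) + q * (2 * B) = q * (4 * B) by ring.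
have B40 : 0 <= 4 * B by exact: mulr_ge0.
rewrite e1; apply: (le_trans (ler_wpM2r B40 qZ)); rewrite /B /lorentz subr0 /k4.
rewrite le_eqVlt; apply/orP; left; apply/eqP.
have oq := onepsqr_gt0 (w X * eta).
by move: pi => p; field; rewrite !gt_eqF.
Qed.

End theta.
End KernelEstimate.

(** * Measurability and the norm of the kernel *)

Section AmNorm.
Local Open Scope complex_scope.
Local Open Scope ring_scope.
Context {R : realType} (D : set R) (F : R -> R).
Hypothesis hD : D = setT \/ D = [set x : R | 0 < x].
Hypothesis hF : warping D F.
Local Notation mu := (@lebesgue_measure R).
Local Notation phi := (warp_inv D F).
Local Notation w := (warp_weight D F).

Lemma measurable_zero_ext (h : R -> R) : measurable_fun D h -> measurable_fun setT (real_zero_ext D h).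
Proof.
move=> /(measurable_restrictT _ (measurable_warp hD)).
by [].
Qed.

Section measurable_kernel.
Variable theta : R -> R[i].
Hypothesis mth : cmeasurable theta.

(* F and its derivative are arbitrary outside D; extended by 0 they are
   measurable on the line, and they define the same kernel on D * D *)
Let Fm := real_zero_ext D F.
Let F1m := real_zero_ext D (derive1 F).
Let mF : measurable_fun setT Fm.
Proof.
by apply: measurable_zero_ext; apply: (measurable_on_warp hD) => t; exact: (warp_cvg hF).
Qed.
Let mF1 : measurable_fun setT F1m.
Proof.
by apply: measurable_zero_ext; apply: (measurable_on_warp hD) => t; exact: (warp_derive1_cvg hF).
Qed.

Let W (z : R * R) : R[i] :=
  (\1_D z.2)%:C * ((Num.sqrt (F1m z.1))%:C * theta (Fm z.2 - Fm z.1)).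

Let mW : cmeasurable W.
Proof.
apply: cmeasurableM.
  apply: cmeasurable_real; apply: (measurable_fun_snd (g := \1_D)).
  by apply: measurable_indic; exact: (measurable_warp hD).
apply: cmeasurableM.
  apply: cmeasurable_real; apply: (measurable_fun_fst (g := fun x => Num.sqrt (F1m x))).
  have ms : measurable_fun setT (Num.sqrt : R -> R).
    by apply: continuous_measurable_fun; exact: sqrt_continuous.
  exact: (measurableT_comp ms).
apply: (cmeasurable_comp (h := fun z : R * R => Fm z.2 - Fm z.1)) mth.
by apply: measurable_funB; [exact: measurable_fun_snd|exact: measurable_fun_fst].
Qed.

Let WE x t : D x -> warped D F theta x t = W (x, t).
Proof.
move=> Dx; rewrite /warped /zero_ext /W /= indicE /Fm /F1m /real_zero_ext (mem_set Dx).
by case: ifP => tD /=; rewrite ?mul1r ?mul0r.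
Qed.

Let At (z : (R * R) * R) : R[i] :=
  cintegral (fun t => W (z.1.1, t) * expi (2 * pi * t * (z.2 - z.1.2))).

Let mAt : cmeasurable At.
Proof.
pose G (u : ((R * R) * R) * R) := W (u.1.1.1, u.2) * expi (2 * pi * u.2 * (u.1.2 - u.1.1.2)).
have m1 : measurable_fun setT (fun u : ((R * R) * R) * R => u.1.1.1).
  by apply: (measurable_fun_fst (g := fun v : (R * R) * R => v.1.1)); apply: (measurable_fun_fst (g := fst)).
have m2 : measurable_fun setT (fun u : ((R * R) * R) * R => u.1.1.2).
  by apply: (measurable_fun_fst (g := fun v : (R * R) * R => v.1.2)); apply: (measurable_fun_fst (g := snd)).
have m3 : measurable_fun setT (fun u : ((R * R) * R) * R => u.1.2).
  by apply: (measurable_fun_fst (g := snd)).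
have [gr gi] : cmeasurable G.
  apply: cmeasurableM.
    apply: (cmeasurable_comp (h := fun u : ((R * R) * R) * R => (u.1.1.1, u.2))) mW.
    by apply: measurable_fun_pair.
  apply: cmeasurable_expi; apply: measurable_funM.
    by apply: measurable_funM => //; exact: measurable_snd.
  exact: measurable_funB.
exact: cmeasurable_cintegral gr gi.
Qed.

Let atomE x xi s : D x -> atom D F theta x xi s = At ((x, xi), s).
Proof.
move=> Dx; rewrite /atom /translate /inv_fourier /At /=.
by apply: eq_cintegral => t; rewrite WE.
Qed.

(** A version of the kernel that is measurable on the whole space; it agrees with
    the kernel when x and y are in D. *)
Definition kernel_meas (p : (R * R) * (R * R)) : R[i] := (sqnormL2 theta)^-1%:C *
  cintegral (fun s => At (p.2, s) * (At (p.1, s))^*).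

Lemma cmeasurable_kernel : cmeasurable kernel_meas.
Proof.
apply: cmeasurableM; first by apply: cmeasurable_real.
pose G (u : ((R * R) * (R * R)) * R) := At (u.1.2, u.2) * (At (u.1.1, u.2))^*.
have m1 : measurable_fun setT (fun u : ((R * R) * (R * R)) * R => u.1.1).
  exact: (measurableT_comp measurable_fst measurable_fst).
have m2 : measurable_fun setT (fun u : ((R * R) * (R * R)) * R => u.1.2).
  exact: (measurableT_comp measurable_snd measurable_fst).
have [gr gi] : cmeasurable G.
  apply: cmeasurableM.
    apply: (cmeasurable_comp (h := fun u : ((R * R) * (R * R)) * R => (u.1.2, u.2))) mAt.
    exact: measurable_fun_pair.
  apply: cmeasurable_conj.
  apply: (cmeasurable_comp (h := fun u : ((R * R) * (R * R)) * R => (u.1.1, u.2))) mAt.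
  exact: measurable_fun_pair.
exact: cmeasurable_cintegral gr gi.
Qed.

Lemma kernel_measE x y xi om : D x -> D y ->
  kernel_K D F theta x y xi om = kernel_meas ((x, xi), (y, om)).
Proof.
move=> Dx Dy; rewrite /kernel_K /kernel_meas /inner.
by rewrite (@eq_cintegral _ _ (fun s => At ((y, om), s) * (At ((x, xi), s))^*))// => s;
  rewrite !atomE.
Qed.

Lemma jointly_measurable_kernel : jointly_measurable D (kernel_K D F theta).
Proof.
have [kr ki] := cmeasurable_kernel.
split.
  apply: (eq_measurable_fun (fun p => complex.Re (kernel_meas p))).
    by move=> [[x xi] [y om]]; rewrite inE => -[Dx Dy]; rewrite -(kernel_measE xi om Dx Dy).
  exact: measurable_funTS.
apply: (eq_measurable_fun (fun p => complex.Im (kernel_meas p))).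
  by move=> [[x xi] [y om]]; rewrite inE => -[Dx Dy]; rewrite -(kernel_measE xi om Dx Dy).
exact: measurable_funTS.
Qed.

End measurable_kernel.

Variable rho : R -> R.
Hypothesis rho_ctl : control_weight rho.
Hypothesis w_rho : forall X Y, w X <= rho (X - Y) * w Y.

Let w0 x : 0 < w x. Proof. exact: (warp_weight_gt0 hF). Qed.

(** The frequency integral is pi / w X times the remaining factor, and
    1 / w X <= rho (X - F y) / w (F y).  The last power of rho then yields the
    majorant of total mass pi. *)
Lemma double_integral_le (X xi C0 : R) (f : R -> R -> R) (fm : R * R -> R) :
  0 <= C0 -> measurable_fun setT fm -> (forall z, 0 <= fm z) ->
  (forall y om, D y -> f y om = fm (y, om)) ->
  (forall y om, D y ->
    f y om <= C0 / rho (X - F y) ^+ 2 / (1 + (w X * (om - xi)) ^+ 2)) ->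
  (\int[mu]_(y in D) \int[mu]_(om in setT) (f y om)%:E <= (C0 * pi * pi)%:E)%E.
Proof.
move=> C00 mfm fm0 fE fle.
have mD := measurable_warp hD.
have Z0 y : 0 < rho (X - F y) by exact: (rho_gt0 rho_ctl).
have Z1 y : 1 <= rho (X - F y) by exact: (rho_ge1 rho_ctl).
have inner_le y : D y ->
    (\int[mu]_om (f y om)%:E <= (C0 * pi * warp_maj F X y)%:E)%E.
  move=> Dy; pose a := C0 / rho (X - F y) ^+ 2 / w X.
  have a0 : 0 <= a by rewrite !divr_ge0 ?exprn_ge0// ltW.
  apply: (@le_trans _ _ (\int[mu]_om (a%:E * (lorentz (w X) xi om)%:E)))%E.
    apply: ge0_le_integral => //.
    - by move=> om _; rewrite fE// lee_fin.
    - apply/measurable_EFinP.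
      rewrite (_ : f y = fun om => fm (y, om)); last by apply/funext => om; exact: fE.
      exact: (measurableT_comp mfm (pair1_measurable y)).
    - apply/measurable_EFinP; apply: measurable_funM => //; exact: measurable_lorentz.
    - move=> om _; rewrite -EFinM lee_fin (le_trans (fle _ _ Dy))// /a /lorentz.
      have oq := onepsqr_gt0 (w X * (om - xi)).
      rewrite le_eqVlt; apply/orP; left; apply/eqP; field.
      by rewrite !gt_eqF.
  rewrite ge0_integralZl//; last 2 first.
  - by apply/measurable_EFinP; exact: measurable_lorentz.
  - by move=> om _; rewrite lee_fin lorentz_ge0// ltW.
  rewrite integral_lorentz// -EFinM lee_fin.
  rewrite (warp_majE hD hF)// [leRHS]mulrAC ler_wpM2r ?pi_ge0//.
  rewrite /a -!mulrA ler_wpM2l// -invfM.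
  rewrite lef_pV2 ?posrE ?mulr_gt0 ?exprn_gt0 ?onepsqr_gt0//.
  have h : w (F y) <= rho (X - F y) * w X.
    by rewrite (rho_sub rho_ctl); exact: w_rho.
  have h2 : 1 + (F y - X) ^+ 2 <= rho (X - F y).
    by rewrite (rho_sub rho_ctl); case: rho_ctl.
  rewrite expr2 -[leRHS]mulrA [leRHS]mulrC; apply: ler_pM => //; first exact: ltW.
  by rewrite ltW// onepsqr_gt0.
have mF : measurable_fun D (fun y => \int[mu]_om (f y om)%:E)%E.
  apply: (eq_measurable_fun (fubini_F mu (EFin \o fm))).
    by move=> y; rewrite inE => Dy; apply: eq_integral => om _; rewrite fE.
  apply: measurable_funTS; apply: measurable_fun_fubini_tonelli_F.
    exact/measurable_EFinP.
  by move=> z; rewrite lee_fin.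
have mi := integrable_warp_maj hD hF X.
apply: (@le_trans _ _ (\int[mu]_(y in D) ((C0 * pi)%:E * (warp_maj F X y)%:E)))%E.
  apply: ge0_le_integral => //.
  - by move=> y Dy; apply: integral_ge0 => om _; rewrite lee_fin fE.
  - apply/measurable_EFinP; apply: measurable_funM => //.
    by have [/measurable_EFinP] := integrableP _ _ _ mi.
have C0p : 0 <= C0 * pi by rewrite mulr_ge0// pi_ge0.
rewrite ge0_integralZl//; last 2 first.
- by have [] := integrableP _ _ _ mi.
- by move=> y Dy; rewrite lee_fin (warp_maj_ge0 hF).
rewrite [X in (_ <= X)%E]EFinM; apply: lee_wpmul2l; first by rewrite lee_fin.
exact: integral_warp_maj_le.
Qed.

Hypothesis hw : C1_on setT w.
Variable (D1 : R).
Hypothesis hD1 : forall x : R, `|derive1 w x / w x| <= D1.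
Variable m1 : R -> R.
Hypothesis (hm1 : weight_on D m1) (m1_meas : measurable_fun D m1).
Hypothesis m1_rho : forall X Y, m1 (phi X) <= rho (X - Y) * m1 (phi Y).

Lemma ratio_weight_le x y xi om : D x -> D y ->
  0 <= ratio_weight m1 x y xi om <= rho (F x - F y).
Proof.
move=> Dx Dy; have mx := hm1 Dx; have my := hm1 Dy.
have h1 := m1_rho (F x) (F y); have h2 := m1_rho (F y) (F x).
rewrite !(warpK hF)// in h1 h2.
rewrite /ratio_weight le_max divr_ge0 ?(ltW mx) ?(ltW my)//= ge_max.
by rewrite !ler_pdivrMr// h1 /= (rho_sub rho_ctl).
Qed.

(** The weight m costs one power of rho, which leaves rho (X - Y)^-4.  This is
    enough for the integral over (y, omega).  For the integral over (x, xi) the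
    width 1 / w X is first replaced by 1 / w Y, at the cost of two more powers. *)
Lemma in_Am_of_rapid (theta : R -> R[i]) (c : R) : 0 <= c ->
  rapid rho c (fun r => complex.Re (theta r)) ->
  rapid rho c (fun r => complex.Im (theta r)) ->
  in_Am D (ratio_weight m1) (kernel_K D F theta).
Proof.
move=> c0 tr ti.
have mth : cmeasurable theta.
  have H u : rapid rho c u -> measurable_fun setT u.
    move=> [u1 [_ [du _ _ _]]]; apply: continuous_measurable_fun => r.
    exact: (is_derive_continuous (du r)).
  by split; exact: H.
split; first exact: jointly_measurable_kernel.
have D10 : 0 <= D1 by exact: le_trans (hD1 0).
pose Ai := (sqnormL2 theta)^-1.
have Ai0 : 0 <= Ai by rewrite invr_ge0; apply: Rintegral_ge0 => x _; exact: sqr_ge0.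
pose C0 := Ai * (32 * c ^+ 2 * (pi * (2 + D1))).
have C00 : 0 <= C0.
  by rewrite mulr_ge0// mulr_ge0 ?mulr_ge0 ?sqr_ge0 ?pi_ge0 ?addr_ge0.
(* on D this is the inverse of m1 *)
pose V x := expR (- ln (real_zero_ext D m1 x)).
pose mm (x y : R) := Num.max (real_zero_ext D m1 x * V y) (real_zero_ext D m1 y * V x).
pose fm (p : (R * R) * (R * R)) := Normc.normc (kernel_meas theta p) * mm p.1.1 p.2.1.
have m1e : measurable_fun setT (real_zero_ext D m1) by exact: measurable_zero_ext.
have m1e0 x : 0 <= real_zero_ext D m1 x.
  by rewrite /real_zero_ext; case: ifP => //; rewrite inE => /hm1 /ltW.
have mm0 x y : 0 <= mm x y by rewrite le_max mulr_ge0// expR_ge0.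
have fm0 p : 0 <= fm p by rewrite mulr_ge0//; case: (kernel_meas _ _) => u v; exact: sqrtr_ge0.
have mV : measurable_fun setT V.
  apply: (measurableT_comp (@measurable_expR R)); apply: measurableT_comp => //.
  exact: (measurableT_comp (@measurable_ln R)).
have VE x : D x -> V x = (m1 x)^-1.
  by move=> Dx; rewrite /V /real_zero_ext mem_set// expRN lnK// posrE; exact: hm1.
have mfm : measurable_fun setT fm.
  apply: measurable_funM.
    by apply: measurable_normc; exact: cmeasurable_kernel.
  have p1 : measurable_fun setT (fun p : (R * R) * (R * R) => p.1.1).
    exact: (measurableT_comp measurable_fst measurable_fst).
  have p2 : measurable_fun setT (fun p : (R * R) * (R * R) => p.2.1).
    exact: (measurableT_comp measurable_fst measurable_snd).
  apply: measurable_maxr; apply: measurable_funM.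
  - exact: (measurableT_comp m1e p1).
  - exact: (measurableT_comp mV p2).
  - exact: (measurableT_comp m1e p2).
  - exact: (measurableT_comp mV p1).
pose f x y xi om := Normc.normc (kernel_K D F theta x y xi om) * ratio_weight m1 x y xi om.
have fE x y xi om : D x -> D y -> f x y xi om = fm ((x, xi), (y, om)).
  by move=> Dx Dy; rewrite /f /fm kernel_measE// /mm !VE// /real_zero_ext /= !mem_set.
have fle x y xi om : D x -> D y ->
    f x y xi om <= C0 / rho (F x - F y) ^+ 4 / (1 + (w (F x) * (om - xi)) ^+ 2).
  move=> Dx Dy; have /andP[r0 rle] := ratio_weight_le xi om Dx Dy.
  rewrite /f /kernel_K Normc.normcM.
  rewrite (_ : Normc.normc (_ %:C) = Ai); last first.
    by rewrite /= expr0n/= addr0 sqrtr_sqr ger0_norm.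
  have kl := kernel_le hD hF hw hD1 rho_ctl w_rho c0 tr ti xi om Dx Dy.
  have Z0 := rho_gt0 rho_ctl (F x - F y).
  rewrite -mulrA; apply: (@le_trans _ _ (Ai *
     (32 * c ^+ 2 * (pi * (2 + D1)) / rho (F x - F y) ^+ 5 /
      (1 + (w (F x) * (xi - om)) ^+ 2) * rho (F x - F y)))).
    apply: ler_wpM2l => //; apply: ler_pM => //.
    by case: (inner _ _) => u v; exact: sqrtr_ge0.
  have -> : (w (F x) * (om - xi)) ^+ 2 = (w (F x) * (xi - om)) ^+ 2 by ring.
  have oq := onepsqr_gt0 (w (F x) * (xi - om)).
  rewrite le_eqVlt; apply/orP; left; apply/eqP; rewrite /C0; move: pi => p; field.
  by rewrite !gt_eqF.
have Zle x y n : (2 <= n)%N -> (rho (F x - F y) ^+ n)^-1 <= (rho (F x - F y) ^+ 2)^-1.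
  move=> n2; rewrite lef_pV2 ?posrE ?exprn_gt0 ?(rho_gt0 rho_ctl)//.
  by rewrite ler_weXn2l// (rho_ge1 rho_ctl).
have bnd1 x xi : D x ->
    (\int[mu]_(y in D) \int[mu]_(om in setT) (f x y xi om)%:E <= (C0 * pi * pi)%:E)%E.
  move=> Dx; apply: (@double_integral_le (F x) xi C0 _ (fun z : R * R => fm ((x, xi), z))) => //.
  - exact: (measurableT_comp mfm (pair1_measurable (x, xi))).
  - by move=> y om Dy; exact: fE.
  - move=> y om Dy; rewrite (le_trans (fle _ _ _ _ Dx Dy))//.
    rewrite ler_wpM2r ?invr_ge0 ?(ltW (onepsqr_gt0 _))//.
    by rewrite ler_wpM2l// Zle.
have bnd2 y om : D y ->
    (\int[mu]_(x in D) \int[mu]_(xi in setT) (f x y xi om)%:E <= (C0 * pi * pi)%:E)%E.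
  move=> Dy; apply: (@double_integral_le (F y) om C0 (fun x xi => f x y xi om)
    (fun z : R * R => fm (z, (y, om)))) => //.
  - exact: (measurableT_comp mfm (pair2_measurable (y, om))).
  - by move=> x xi Dx; exact: fE.
  - move=> x xi Dx; rewrite (le_trans (fle _ _ _ _ Dx Dy))//.
    rewrite (rho_sub rho_ctl (F y)); set Z := rho _.
    have Z0 : 0 < Z by exact: (rho_gt0 rho_ctl).
    have Z1 : 1 <= Z by exact: (rho_ge1 rho_ctl).
    have wZ : w (F y) <= Z * w (F x) by rewrite /Z (rho_sub rho_ctl); exact: w_rho.
    rewrite -[leLHS]mulrA -[leRHS]mulrA; apply: ler_wpM2l => //.
    rewrite -[leLHS]invfM -[leRHS]invfM lef_pV2 ?posrE ?mulr_gt0 ?exprn_gt0 ?onepsqr_gt0//.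
    rewrite [leRHS](_ : _ = Z ^+ 2 * (Z ^+ 2 * (1 + (w (F x) * (om - xi)) ^+ 2))); last by ring.
    apply: ler_wpM2l; first exact: sqr_ge0.
    rewrite [leRHS]mulrDr [X in _ <= X + _]mulr1; apply: lerD.
      by rewrite expr_ge1// ltW.
    rewrite -[leRHS]exprMn mulrA -[leLHS]sqrrN -mulrN opprB !exprMn.
    apply: ler_wpM2r; first exact: sqr_ge0.
    rewrite -exprMn lerXn2r// nnegrE; first exact: ltW.
    by apply: mulr_ge0; exact: ltW.
rewrite /norm_Am /norm_A1.
apply: (@le_lt_trans _ _ (C0 * pi * pi)%:E); last exact: ltry.
have B0 : 0 <= C0 * pi * pi by apply: mulr_ge0; [apply: mulr_ge0|] => //; exact: pi_ge0.
rewrite ge_max; apply/andP; split; apply/ess_supP; apply: aeW => -[u v] /=;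
  case: ifP => [|_]; rewrite ?inE ?lee_fin// => Du; [exact: bnd1|exact: bnd2].
Qed.

End AmNorm.

(** * Uniform boundedness of ratios of a moderate function *)

Section UniformBoundedness.
Context {R : realType}.
Local Notation mu := (@lebesgue_measure R).

(** The sets of l in [0, 3] with |h (l + Y m) - h (Y m)| <= m for all m >= n
    increase to [0, 3], so their measures exceed 5/2 from some n on. *)
Lemma measure_eventually_gt (h : R -> R) (Y : nat -> R) :
  measurable_fun setT h -> (forall l : R, exists b : R, forall y : R, `|h (l + y) - h y| <= b) ->
  exists N, forall n, (N <= n)%N -> exists E : set (measurableTypeR R),
    [/\ measurable E, E `<=` (`[0, 3]%classic : set R),
    ((5 / 2)%:E < mu E)%E &
    forall l : R, E l -> `|h (l + Y n) - h (Y n)| <= n%:R].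
Proof.
move=> mh hb.
pose G m : set (measurableTypeR R) := [set l : R | `|h (l + Y m) - h (Y m)| <= m%:R].
have mG m : measurable (G m).
  have mg : measurable_fun setT (fun l : R => `|h (l + Y m) - h (Y m)|).
    apply: measurableT_comp => //; apply: measurable_funB => //.
    by apply: (measurableT_comp mh); apply: measurable_funD.
  rewrite (_ : G m = (fun l : R => `|h (l + Y m) - h (Y m)|) @^-1` `]-oo, m%:R]).
    by rewrite -[X in measurable X]setTI; apply: mg => //; exact: measurable_itv.
  by apply/seteqP; split => l /=; rewrite in_itv.
pose E n : set (measurableTypeR R) := (`[0, 3]%classic : set R) `&` \bigcap_(m in [set m | (n <= m)%N]) G m.
have mE n : measurable (E n).
  apply: measurableI; first exact: measurable_itv.
  by apply: bigcap_measurable => [|m _]; [exists n => /=|exact: mG].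
have ndE : {homo E : n m / (n <= m)%N >-> (n <= m)%O}.
  move=> n m nm; apply/subsetPset => l [l03 lG]; split => // k /= mk.
  by apply: lG => /=; exact: leq_trans mk.
have UE : \bigcup_n E n = (`[0, 3]%classic : set R).
  apply/seteqP; split=> [l [n _ []]//|l l03].
  have [b hlb] := hb l; exists (Num.trunc `|b|).+1 => //; split => // m /= bm.
  rewrite /G /= (le_trans (hlb _))// (le_trans (ler_norm _))// ltW//.
  by rewrite (lt_le_trans (truncnS_gt _))// ler_nat.
have : (mu \o E) x @[x --> \oo] --> mu (\bigcup_n E n).
  apply: nondecreasing_cvg_mu => //; rewrite UE; exact: measurable_itv.
rewrite UE (lebesgue_measure_itv `[0, 3]) /= lte_fin ltr0n /= oppr0 addr0 => cE.
have : \forall n \near \oo, ((5 / 2)%:E < mu (E n))%E.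
  apply: (cE [set z | (5 / 2)%:E < z]%E); apply: open_nbhs_nbhs; split.
    exact: open_ereal_gt_ereal.
  by rewrite /= lte_fin; lra.
move=> [N _ HN]; exists N => n Nn; exists (E n); split => //.
- by move=> l [].
- exact: HN.
- by move=> l [_ lG]; exact: (lG n (leqnn n)).
Qed.

(** Suppose |h x_n - h y_n| > 2 n with |x_n - y_n| <= 1.  The good sets for x_n and
    for y_n, the former translated by x_n - y_n, lie in an interval of length 5
    and each has measure above 5/2.  At a common point l the value
    h (l + y_n) is within n of both h x_n and h y_n, a contradiction. *)
Lemma bounded_oscillation (h : R -> R) : measurable_fun setT h ->
  (forall l : R, exists b : R, forall y : R, `|h (l + y) - h y| <= b) ->
  exists M : R, forall x y, `|x - y| <= 1 -> `|h x - h y| <= M.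
Proof.
move=> mh hb; apply: contrapT => nM.
have /choice[XY HXY] : forall n : nat, exists p : R * R,
    `|p.1 - p.2| <= 1 /\ n%:R * 2 < `|h p.1 - h p.2|.
  move=> n; apply: contrapT => H; apply: nM; exists (n%:R * 2) => x y xy.
  rewrite leNgt; apply/negP => lt; apply: H; by exists (x, y).
have [N1 H1] := measure_eventually_gt (fun n => (XY n).1) mh hb.
have [N2 H2] := measure_eventually_gt (fun n => (XY n).2) mh hb.
pose n := maxn N1 N2.
have [I [mI sI gI hI]] := H1 n (leq_maxl _ _).
have [J [mJ sJ gJ hJ]] := H2 n (leq_maxr _ _).
have [cn hn] := HXY n.
set x := (XY n).1 in cn hn hI; set y := (XY n).2 in cn hn hJ.
pose I' : set (measurableTypeR R) := (fun l : R => l - (x - y)) @^-1` I.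
have mI' : measurable I'.
  rewrite -[X in measurable X]setTI.
  have mc : measurable_fun [set: R] (fun l : R => l - (x - y)) by apply: measurable_funB.
  exact: mc.
have gI' : mu I' = mu I by exact: lebesgue_measure_shift.
have IJ : I' `&` J = set0.
  apply/seteqP; split=> l // -[lI lJ]; move: hn; apply/negP; rewrite -leNgt.
  have := hI _ lI; have := hJ _ lJ.
  rewrite (_ : l - (x - y) + x = l + y); last by ring.
  move=> a1 a2; rewrite (_ : h x - h y = (h (l + y) - h y) - (h (l + y) - h x)); last by ring.
  by rewrite (le_trans (ler_normB _ _))// mulr_natr mulr2n lerD.
have : (mu (I' `|` J) <= mu (`[(- 1)%R, 4%R]%classic : set R))%E.
  apply: le_measure; rewrite ?inE.
  - exact: measurableU.
  - exact: measurable_itv.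
  - move: cn; rewrite ler_norml => /andP[c1 c2].
    move=> l [/sI|/sJ] /=; rewrite !in_itv /= => /andP[l1 l2]; lra.
rewrite measureU// lebesgue_measure_itv /= lte_fin ifT; last by lra.
rewrite gI' leNgt => /negP; apply.
rewrite -EFinD (_ : 4 + - (- 1) = 5 / 2 + 5 / 2 :> R); last by lra.
by rewrite EFinD; apply: lteD.
Qed.

(** The bound is iterated along a chain of steps of length at most 1 from y to x. *)
Lemma exp_growth_of_unit_ratio (u : R -> R) (M : R) : (forall x, 0 < u x) -> 1 <= M ->
  (forall x y, `|x - y| <= 1 -> u x <= M * u y) ->
  forall x y, u x <= M * expR (ln M * `|x - y|) * u y.
Proof.
move=> u0 M1 uM.
have M0 : 0 < M by exact: lt_le_trans M1.
have H n : forall x y, `|x - y| <= n%:R -> u x <= M ^+ n * u y.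
  elim: n => [x y|n IHn x y xy].
    by rewrite normr_le0 subr_eq0 => /eqP ->; rewrite expr0 mul1r.
  pose z := x - (x - y) / n.+1%:R.
  have n0 : 0 < n.+1%:R :> R by rewrite ltr0n.
  have xz : `|x - z| <= 1.
    rewrite /z opprB addrC subrK normrM normfV (ger0_norm (ltW n0)).
    by rewrite ler_pdivrMr// mul1r.
  have zy : `|z - y| <= n%:R.
    rewrite /z (_ : _ - _ - y = (x - y) * (n%:R / n.+1%:R)); last first.
      by rewrite -natr1; field; rewrite natr1 gt_eqF.
    rewrite normrM [X in _ * X]ger0_norm ?divr_ge0//.
    by rewrite mulrA ler_pdivrMr// mulrC ler_wpM2l.
  rewrite (le_trans (uM _ _ xz))// exprS -mulrA ler_wpM2l ?(ltW M0)//.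
  exact: IHn.
move=> x y.
have := H (Num.trunc `|x - y|).+1 x y (ltW (truncnS_gt _)) => /le_trans; apply.
rewrite ler_wpM2r ?(ltW (u0 y))// exprS ler_wpM2l ?(ltW M0)//.
rewrite -{1}(lnK M0) -expRM_natr ler_expR ler_wpM2l ?ln_ge0//.
by rewrite truncn_le.
Qed.

End UniformBoundedness.

(** * Exponential and polynomial control weights *)

Section ControlWeights.
Context {R : realType}.

Lemma control_expR (M k : R) : 1 <= M -> 2 <= k ->
  control_weight (fun z => M * expR (k * `|z|)).
Proof.
move=> M1 k2; have M0 : 0 <= M by exact: le_trans M1.
split.
- move=> z; rewrite -[leLHS]mul1r; apply: ler_pM => //.
    by rewrite addr_ge0// sqr_ge0.
  apply: (@le_trans _ _ ((1 + `|z|) ^+ 2)).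
    rewrite sqrrD expr1n mul1r -[X in 1 + X <= _]real_normK ?num_real//.
    by have := normr_ge0 z; lra.
  apply: (@le_trans _ _ (expR `|z| ^+ 2)).
    by rewrite lerXn2r ?nnegrE ?addr_ge0 ?expR_ge0// expR_ge1Dx.
  by rewrite -expRM_natl ler_expR ler_wpM2r.
- by move=> z; rewrite normrN.
- move=> x y; rewrite mulrACA -expRD -mulrDr.
  apply: ler_pM; rewrite ?expR_ge0//; first by rewrite ler_peMr.
  rewrite ler_expR ler_wpM2l ?ler_normD//.
  by rewrite (le_trans _ k2).
Qed.

Lemma control_poly (M : R) (n : nat) : 1 <= M -> (2 <= n)%N ->
  control_weight (fun z => M * (1 + `|z|) ^+ n).
Proof.
move=> M1 n2; have M0 : 0 <= M by exact: le_trans M1.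
have p1 (z : R) : 1 <= 1 + `|z| by rewrite lerDl.
split.
- move=> z; rewrite -[leLHS]mul1r; apply: ler_pM => //.
    by rewrite addr_ge0// sqr_ge0.
  apply: (@le_trans _ _ ((1 + `|z|) ^+ 2)); last by rewrite ler_weXn2l.
  rewrite sqrrD expr1n mul1r -[X in 1 + X <= _]real_normK ?num_real//.
  by have := normr_ge0 z; lra.
- by move=> z; rewrite normrN.
- move=> x y; rewrite mulrACA -exprMn.
  apply: ler_pM; rewrite ?exprn_ge0 ?addr_ge0//; first by rewrite ler_peMr.
  rewrite lerXn2r ?nnegrE ?mulr_ge0 ?addr_ge0//.
  rewrite mulrDl mul1r mulrDr mulr1 -addrA lerD2l.
  have := mulr_ge0 (normr_ge0 x) (normr_ge0 y); have := ler_normD x y; lra.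
Qed.

(** The growth condition speaks of neighbourhoods of the two infinities only.
    Submultiplicativity carries it to the bounded middle part, whose points are
    translates by - 2 B of points far to the right. *)
Lemma poly_growth_global (v : R -> R) (K p : R) : (forall x, 0 < v x) ->
  (forall x y, v (x + y) <= K * v x * v y) -> poly_growth v p ->
  exists M n, 0 <= M /\ forall x, v x <= M * (1 + `|x|) ^+ n.
Proof.
move=> v0 vK [[C1 [A1 [_ H1]]] [C2 [A2 [_ H2]]]].
have K0 : 0 < K.
  have := vK 0 0; rewrite addr0 -mulrA -[X in X <= _]mul1r.
  have v00 := v0 0.
  move=> h; rewrite ltNge; apply/negP => Kle.
  have : K * (v 0 * v 0) <= 0 by rewrite mulr_le0_ge0// mulr_ge0// ltW.
  by rewrite leNgt => /negP; apply; apply: lt_le_trans h; rewrite mul1r.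
pose B := `|A1| + `|A2| + 1.
have B0 : 0 < B by rewrite ltr_wpDl ?addr_ge0.
pose n := (Num.trunc `|p|).+1.
pose C := `|C1| + `|C2|.
have far x : B <= `|x| -> v x <= C * (1 + `|x|) ^+ n.
  move=> Bx.
  have pn : (1 + `|x|) `^ p <= (1 + `|x|) ^+ n.
    rewrite -powR_mulrn ?addr_ge0// ler_powR ?lerDl//.
    by rewrite (le_trans (ler_norm _))// ltW// truncnS_gt.
  have : v x <= C * (1 + `|x|) `^ p.
    have P0 : 0 <= (1 + `|x|) `^ p by exact: powR_ge0.
    have [x0|x0] := leP 0 x.
      have := H1 x; rewrite (ger0_norm x0) in Bx *.
      rewrite ger0_norm ?(ltW (v0 x))// ger0_norm ?powR_ge0// => h.
      rewrite (le_trans (h _))//.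
        rewrite (lt_le_trans _ Bx)// /B; have := ler_norm A1; have := normr_ge0 A2; lra.
      rewrite ler_wpM2r ?powR_ge0// (le_trans (ler_norm _))// lerDl//.
    have := H2 x; rewrite (ltr0_norm x0) in Bx *.
    rewrite ger0_norm ?(ltW (v0 x))// ger0_norm ?powR_ge0// => h.
    rewrite (le_trans (h _))//.
      rewrite /B in Bx; have := ler_norm (- A2); rewrite normrN; have := normr_ge0 A1; lra.
    rewrite ler_wpM2r ?powR_ge0// (le_trans (ler_norm _))// lerDr//.
  move=> h; rewrite (le_trans h)// ler_wpM2l// addr_ge0//.
pose M := C + K * (C * (1 + 3 * B) ^+ n) * v (- (2 * B)).
have C0 : 0 <= C by rewrite addr_ge0.
have T0 : 0 <= K * (C * (1 + 3 * B) ^+ n) * v (- (2 * B)).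
  apply: mulr_ge0; last exact: ltW.
  apply: mulr_ge0; first exact: ltW.
  by rewrite mulr_ge0// exprn_ge0// addr_ge0// mulr_ge0// ltW.
have p1 (x : R) : 1 <= (1 + `|x|) ^+ n by rewrite exprn_ege1// lerDl.
exists M, n; split; first by rewrite addr_ge0.
move=> x; have [Bx|xB] := leP B `|x|.
  rewrite (le_trans (far _ Bx))// ler_wpM2r ?(le_trans _ (p1 x))//.
  by rewrite lerDl.
move: xB; rewrite ltr_norml => /andP[x1 x2].
have x20 : 0 <= x + 2 * B by lra.
have E : `|x + 2 * B| <= 3 * B by rewrite ger0_norm//; lra.
apply: (@le_trans _ _ M); last first.
  by rewrite ler_peMr// addr_ge0.
rewrite /M; apply: ler_wpDl => //.
have -> : v x = v ((x + 2 * B) + - (2 * B)) by congr v; ring.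
rewrite (le_trans (vK _ _))//; apply: ler_wpM2r; first exact: ltW.
apply: ler_wpM2l; first exact: ltW.
rewrite (le_trans (far _ _))//; first by rewrite ger0_norm//; lra.
apply: ler_wpM2l => //; rewrite lerXn2r ?nnegrE ?addr_ge0 ?mulr_ge0 ?(ltW B0)//.
by rewrite lerD2l.
Qed.

(** The logarithm of w is Lipschitz by the mean value theorem. *)
Lemma exp_growth_of_log_derivative (w w1 : R -> R) (D1 : R) : (forall x, 0 < w x) ->
  (forall x : R, is_derive x 1 w (w1 x)) -> (forall x, `|w1 x / w x| <= D1) ->
  forall X Y, w X <= expR (D1 * `|X - Y|) * w Y.
Proof.
move=> w0 dw D1w X Y.
have dl (x : R) : is_derive x 1 (fun x => ln (w x)) (w1 x / w x).
  have dln := is_derive1_ln (w0 x).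
  by rewrite mulrC; exact: (@is_derive1_comp _ (@ln R) w _ _ _ dln (dw x)).
have key a b : a < b -> `|ln (w b) - ln (w a)| <= D1 * `|b - a|.
  move=> ab.
  have [|c _ ->] := @MVT R (fun x => ln (w x)) (fun x => w1 x / w x) a b ab.
  - by apply: continuous_subspaceT => x; exact: (is_derive_continuous (dl x)).
  - by rewrite normrM ler_wpM2r.
have lip : ln (w X) - ln (w Y) <= D1 * `|X - Y|.
  have [XY|XY|->] := ltgtP X Y.
  - by rewrite (le_trans (ler_norm _))// distrC [`|X - Y|]distrC; exact: key.
  - by rewrite (le_trans (ler_norm _))//; exact: key.
  - by rewrite !subrr normr0 mulr0.
have wXY : w X = expR (ln (w X) - ln (w Y)) * w Y.
  by rewrite -{2}(@lnK _ (w Y)) ?posrE// -expRD subrK lnK// posrE.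
by rewrite wXY ler_wpM2r ?(ltW (w0 Y))// ler_expR.
Qed.

Lemma rapid_of_smooth (rho h : R -> R) : (forall z, 0 < rho z) -> smooth_real h ->
  (forall k, exists c, forall x, `|derive1n k h x| * rho x ^+ 8 <= c) ->
  exists c, 0 <= c /\ forall c', c <= c' -> rapid rho c' h.
Proof.
move=> r0 sh hc; have [c0 h0] := hc 0%N; have [c1 h1] := hc 1%N; have [c2 h2] := hc 2%N.
exists (`|c0| + `|c1| + `|c2|); split; first by rewrite !addr_ge0.
move=> c cc; exists (derive1n 1 h), (derive1n 2 h).
have d n (r : R) : is_derive r 1 (derive1n n h) (derive1n n.+1 h r).
  by split; [exact: sh|rewrite derive1nS derive1E].
have p k x : `|derive1n k h x| * rho x ^+ 8 <= c -> `|derive1n k h x| <= c / rho x ^+ 8.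
  by rewrite ler_pdivlMr// exprn_gt0.
split.
- by move=> r; exact: (d 0%N).
- by move=> r; exact: (d 1%N).
- by move=> r; exact: (is_derive_continuous (d 2%N r)).
- move=> x; have := h0 x; have := h1 x; have := h2 x => g2 g1 g0.
  have a0 := ler_norm c0; have a1 := ler_norm c1; have a2 := ler_norm c2.
  have b0 := normr_ge0 c0; have b1 := normr_ge0 c1; have b2 := normr_ge0 c2.
  split; [apply: (p 0%N)|apply: (p 1%N)|apply: (p 2%N)]; lra.
Qed.

Lemma compact_support_derive1n (h : R -> R) (L : R) :
  (forall x, L < `|x| -> h x = 0) -> forall k x, L < `|x| -> derive1n k h x = 0.
Proof.
move=> h0; elim => [//|k IHk] x Lx.
rewrite derive1nS derive1E (@near_eq_derive _ _ _ _ (cst 0)) ?derive_cst//.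
have : \forall y \near x, L < `|y|.
  have nc : `|y| @[y --> x] --> `|x| by exact: norm_continuous.
  exact: (cvgr_gt _ nc).
by apply: filterS => y /IHk.
Qed.

Lemma compact_support_bounded (rho h : R -> R) (L : R) :
  continuous rho -> smooth_real h -> (forall x, L < `|x| -> h x = 0) ->
  forall k, exists c, forall x, `|derive1n k h x| * rho x ^+ 8 <= c.
Proof.
move=> crho sh h0 k.
pose g x := `|derive1n k h x| * rho x ^+ 8.
have cg : continuous g.
  move=> x; apply: cvgM; last first.
    exact: (@continuous_comp _ _ _ rho (fun y => y ^+ 8) x (crho x) (@exprn_continuous R 8 (rho x))).
  apply: cvg_norm; apply/differentiable_continuous/derivable1_diffP; exact: sh.
pose B := `|L| + 1.
have BB : - B <= B by rewrite /B; have := normr_ge0 L; lra.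
have [c _ cM] := EVT_max BB (continuous_subspaceT cg).
exists `|g c| => x.
have [xB|Bx] := leP `|x| B.
  rewrite (le_trans (cM x _)) ?ler_norm//.
  by rewrite in_itv /= -ler_norml.
rewrite (compact_support_derive1n h0); first by rewrite normr0 mul0r.
by rewrite (le_lt_trans _ Bx)// /B; have := ler_norm L; lra.
Qed.

Lemma rapidly_decreasing_bounded (h : R -> R) (M : R) (n : nat) : 0 <= M ->
  rapidly_decreasing h ->
  forall k, exists c, forall x, `|derive1n k h x| * (M * (1 + `|x|) ^+ n) ^+ 8 <= c.
Proof.
move=> M0 rd k.
have [c0 h0] := rd 0%N k; have [c1 h1] := rd (n * 8)%N k.
exists (M ^+ 8 * 2 ^+ (n * 8) * (c0 + c1)) => x.
rewrite exprMn -exprM.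
have b : (1 + `|x|) ^+ (n * 8) <= 2 ^+ (n * 8) * (1 + `|x| ^+ (n * 8)).
  have [x1|x1] := leP `|x| 1.
    apply: (@le_trans _ _ (2 ^+ (n * 8))).
      by rewrite lerXn2r ?nnegrE ?addr_ge0//; lra.
    by rewrite ler_peMr// lerDl exprn_ge0.
  apply: (@le_trans _ _ ((2 * `|x|) ^+ (n * 8))).
    by rewrite lerXn2r ?nnegrE ?addr_ge0 ?mulr_ge0//; lra.
  by rewrite exprMn ler_wpM2l// lerDr.
rewrite mulrCA -[leRHS]mulrA; apply: ler_wpM2l; first exact: exprn_ge0.
apply: (@le_trans _ _ (`|derive1n k h x| * (2 ^+ (n * 8) * (1 + `|x| ^+ (n * 8))))).
  exact: ler_wpM2l.
rewrite mulrCA; apply: ler_wpM2l; first exact: exprn_ge0.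
rewrite mulrDr mulr1; apply: lerD.
  by have := h0 x; rewrite expr0 mul1r.
by rewrite mulrC.
Qed.

End ControlWeights.

(** * The theorem *)

Section Cases.
Context {R : realType} (D : set R) (F : R -> R).
Hypothesis hD : D = setT \/ D = [set x : R | 0 < x].
Hypothesis hF : warping D F.
Local Notation phi := (warp_inv D F).
Local Notation w := (warp_weight D F).

Lemma warp_inv_is_derive (X : R) : is_derive X 1 phi (w X).
Proof.
have oD := warp_open hD; have DX := warp_inv_in hF X.
have nD : \forall x \near phi X, D x by exact: open_nbhs_nbhs.
have dE : derive1 F (phi X) = (w X)^-1.
  by rewrite (warp_weight_derive1 hD hF DX) (warp_invK hF).
have := @is_derive_inverse R F phi (w X)^-1 (phi X).
rewrite (warp_invK hF) invrK; apply.
- by near=> x; apply: (warpK hF); near: x.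
- by near=> x; apply: (warp_cvg hF); near: x.
- by rewrite -dE; exact: (warp_is_derive hF).
- by rewrite invr_eq0 gt_eqF// (warp_weight_gt0 hF).
Unshelve. all: by end_near.
Qed.

Lemma measurable_comp_warp_inv (m1 : R -> R) : measurable_fun D m1 ->
  measurable_fun setT (m1 \o phi).
Proof.
move=> mm; apply: (measurable_comp (F := D)) => //.
- exact: (measurable_warp hD).
- by move=> _ [X _ <-]; exact: (warp_inv_in hF).
- apply: continuous_measurable_fun => X.
  exact: (is_derive_continuous (warp_inv_is_derive X)).
Qed.

Hypothesis hw : C1_on setT w.
Variable (D1 : R).
Hypothesis hD1 : forall x : R, `|derive1 w x / w x| <= D1.
Variable m1 : R -> R.
Hypothesis (hm1 : weight_on D m1) (m1_meas : measurable_fun D m1).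

Lemma in_Am_of_bounded (rho : R -> R) (theta : R -> R[i]) : control_weight rho ->
  (forall X Y, w X <= rho (X - Y) * w Y) ->
  (forall X Y, m1 (phi X) <= rho (X - Y) * m1 (phi Y)) ->
  smooth theta ->
  (forall k, exists c, forall x, `|derive1n k (Re_fun theta) x| * rho x ^+ 8 <= c) ->
  (forall k, exists c, forall x, `|derive1n k (Im_fun theta) x| * rho x ^+ 8 <= c) ->
  in_Am D (ratio_weight m1) (kernel_K D F theta).
Proof.
move=> rc wr mr [sr si] br bi.
have r0 := rho_gt0 rc.
have [c1 [c10 h1]] := rapid_of_smooth r0 sr br.
have [c2 [c20 h2]] := rapid_of_smooth r0 si bi.
apply: (in_Am_of_rapid hD hF rc wr hw hD1 hm1 m1_meas mr (c := c1 + c2)).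
- exact: addr_ge0.
- by apply: h1; rewrite lerDl.
- by apply: h2; rewrite lerDr.
Qed.

End Cases.

Theorem theorem5p1 (R : realType) (D : set R)
    (hD : D = setT \/ D = [set x : R | 0 < x])
    (F : R -> R) (hF : warping D F)
    (hw : C1_on setT (warp_weight D F))
    (C : R)
    (hC : forall x y : R,
       warp_weight D F (x + y) / (warp_weight D F x * warp_weight D F y) <= C)
    (D1 : R)
    (hD1 : forall x : R, `|derive1 (warp_weight D F) x / warp_weight D F x| <= D1)
    (m1 : R -> R) (hm1 : weight_on D m1) (hm1_meas : measurable_fun D m1)
    (v1 : R -> R) (hv1 : symmetric_weight v1)
    (hmod : moderate v1 (m1 \o warp_inv D F)) :
  (forall theta : R -> R[i], Cc_infty theta -> theta <> (fun=> 0) ->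
     in_Am D (ratio_weight m1) (kernel_K D F theta)) /\
  ((exists p : R, [/\ 0 < p, poly_growth (warp_weight D F) p &
                      poly_growth v1 p]) ->
   forall theta : R -> R[i], schwartz theta -> theta <> (fun=> 0) ->
     in_Am D (ratio_weight m1) (kernel_K D F theta)).
Proof.
have w0 := warp_weight_gt0 hF.
have D10 : 0 <= D1 by exact: le_trans (hD1 0).
have [[v0 vM] u0 [C' uC']] := hmod.
set u := m1 \o warp_inv D F in u0 uC'.
have {}u0 x : 0 < u x by exact: u0.
have {}v0 x : 0 < v1 x by exact: v0.
split=> [theta [sth cth] _|[p [p0 wp vp]] theta [sth rr ri] _].
- have mu : measurable_fun setT u by exact: measurable_comp_warp_inv.
  pose h x := ln (u x).
  have mh : measurable_fun setT h by apply: (measurableT_comp (@measurable_ln R)).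
  have C'0 : 0 < C'.
    have := uC' 0 0; rewrite addr0 -mulrA -ler_pdivrMr ?mulr_gt0//.
    by apply: lt_le_trans; rewrite divr_gt0// mulr_gt0.
  have hb l : exists b : R, forall y : R, `|h (l + y) - h y| <= b.
    exists (`|ln (C' * v1 l)| + `|ln (C' * v1 (- l))|) => y.
    have h1 : h (l + y) - h y <= ln (C' * v1 l).
      rewrite lerBlDr /h -lnM ?posrE ?mulr_gt0// ler_ln ?posrE ?mulr_gt0//.
    have h2 : h y - h (l + y) <= ln (C' * v1 (- l)).
      rewrite lerBlDr /h -lnM ?posrE ?mulr_gt0// ler_ln ?posrE ?mulr_gt0//.
      by rewrite -{1}(addKr l y).
    have a1 := ler_norm (ln (C' * v1 l)); have a2 := ler_norm (ln (C' * v1 (- l))).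
    have b1 := normr_ge0 (ln (C' * v1 l)); have b2 := normr_ge0 (ln (C' * v1 (- l))).
    rewrite ler_norml; apply/andP; split; lra.
  have [M0 hM0] := bounded_oscillation mh hb.
  pose M := expR `|M0|.
  have M1 : 1 <= M by rewrite -expR0 ler_expR.
  have ratio x y : `|x - y| <= 1 -> u x <= M * u y.
    move=> /hM0 xy.
    have : ln (u x) <= `|M0| + ln (u y).
      by rewrite -lerBlDr (le_trans (ler_norm _))// (le_trans xy)// ler_norm.
    by rewrite -ler_expR expRD !lnK ?posrE.
  have ug := exp_growth_of_unit_ratio u0 M1 ratio.
  have dw x := warp_weight_is_derive hw x.
  have wg := exp_growth_of_log_derivative w0 dw hD1.
  have M0' : 0 < M by exact: lt_le_trans M1.
  have lM : 0 <= ln M by exact: ln_ge0.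
  pose k := 2 + D1 + ln M.
  pose rho (z : R) : R := M * expR (k * `|z|).
  have crho : continuous rho.
    move=> x; apply: cvgM; first exact: cvg_cst.
    apply: continuous_comp; last exact: continuous_expR.
    by apply: cvgM; [exact: cvg_cst|exact: norm_continuous].
  have k2 : 2 <= k by rewrite /k; lra.
  have [L hL] : exists L, forall x, L < `|x| -> theta x = 0.
    have [L [_ HL]] := compact_bounded cth.
    exists (L + 1) => x Lx; apply/eqP; apply: contraTT Lx => tx.
    rewrite -leNgt; apply: HL; first by rewrite ltrDl.
    exact: subset_closure.
  apply: (in_Am_of_bounded hD hF hw hD1 hm1 hm1_meas (rho := rho)) => //.
  + exact: control_expR.
  + move=> X Y; rewrite (le_trans (wg X Y))// ler_wpM2r ?(ltW (w0 Y))//.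
    rewrite /rho -[leLHS]mul1r; apply: ler_pM => //.
    by rewrite ler_expR ler_wpM2r// /k; lra.
  + move=> X Y; rewrite (le_trans (ug X Y))// ler_wpM2r ?(ltW (u0 Y))//.
    rewrite /rho; apply: ler_wpM2l; first exact: ltW.
    by rewrite ler_expR ler_wpM2r// /k; lra.
  + case: sth => sr si; apply: (compact_support_bounded crho sr (L := L)).
    by move=> x /hL; rewrite /Re_fun => ->.
  + case: sth => sr si; apply: (compact_support_bounded crho si (L := L)).
    by move=> x /hL; rewrite /Im_fun => ->.
- have wC x y : warp_weight D F (x + y) <= C * warp_weight D F x * warp_weight D F y.
    by rewrite -mulrA -ler_pdivrMr ?mulr_gt0.
  have vC x y : v1 (x + y) <= 1 * v1 x * v1 y by rewrite mul1r.
  have [Mw [nw [Mw0 wg]]] := poly_growth_global w0 wC wp.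
  have [Mv [nv [Mv0 vg]]] := poly_growth_global v0 vC vp.
  pose M := 1 + `|C| * Mw + `|C'| * Mv.
  have cw : 0 <= `|C| * Mw by rewrite mulr_ge0.
  have cv : 0 <= `|C'| * Mv by rewrite mulr_ge0.
  have M1 : 1 <= M by rewrite /M; lra.
  pose n := (2 + nw + nv)%N.
  have p1 (z : R) : 1 <= 1 + `|z| by rewrite lerDl.
  have pn (z : R) m : (m <= n)%N -> (1 + `|z|) ^+ m <= (1 + `|z|) ^+ n.
    by move=> mn; rewrite ler_weXn2l.
  pose rho (z : R) : R := M * (1 + `|z|) ^+ n.
  have M0 : 0 <= M by exact: le_trans M1.
  have growth (g : R -> R) (K Mg : R) (m : nat) z : (forall x, 0 < g x) -> 0 <= Mg ->
      (m <= n)%N -> `|K| * Mg <= M -> g z <= Mg * (1 + `|z|) ^+ m -> K * g z <= rho z.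
    move=> g0 Mg0 mn KM gM.
    apply: (@le_trans _ _ (`|K| * g z)).
      by apply: ler_wpM2r; [exact: ltW|exact: ler_norm].
    apply: (@le_trans _ _ (`|K| * (Mg * (1 + `|z|) ^+ m))).
      exact: ler_wpM2l.
    rewrite mulrA; apply: ler_pM => //; last exact: pn.
      by rewrite mulr_ge0.
  apply: (in_Am_of_bounded hD hF hw hD1 hm1 hm1_meas (rho := rho)) => //.
  + exact: control_poly.
  + move=> X Y; rewrite -{1}(subrK Y X) (le_trans (wC _ _))//.
    apply: ler_wpM2r; first exact: ltW.
    apply: (growth _ _ Mw nw) => //; first by rewrite /n addnAC leq_addl.
    by rewrite /M; lra.
  + move=> X Y; rewrite -{1}(subrK Y X) (le_trans (uC' _ _))//.
    apply: ler_wpM2r; first exact: ltW.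
    apply: (growth _ _ Mv nv) => //; first by rewrite /n leq_addl.
    by rewrite /M; lra.
  + by move=> k; exact: rapidly_decreasing_bounded.
  + by move=> k; exact: rapidly_decreasing_bounded.
Qed.
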